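(* Let $X,Y$ be normed spaces and let $G=(V,E)$ be a graph. (i) If $G$ is $(X,\ell_\infty)$-flattenable, then $G$ is $(X,Y)$-flattenable. (ii) Suppose $X$ is finite-dimensional and $Y$ is infinite-dimensional. If $G$ is $(X,Y)$-flattenable, then $G$ is $(X,\ell_2)$-flattenable.
   Context: All normed spaces are real and have dimension greater than zero. A graph $G=(V,E)$ is finite and simple with at least one edge. The measurement map of $(G,X)$ is $f_{G,X}:X^V\to\mathbb{R}^E$, $(x_v)_{v\in V}\mapsto(\|x_v-x_w\|_X)_{vw\in E}$. The graph $G$ is $(X,Y)$-flattenable if $f_{G,X}(X^V)\supseteq f_{G,Y}(Y^V)$. Here $\ell_p$ ($p\in[1,\infty]$) denotes the real sequence space $\ell_p(\mathbb{N})$ with its usual norm $\|\cdot\|_p$; in particular $\ell_\infty$ is the space of bounded real sequences with the supremum norm. *)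

(* Defs.v *)
From HB Require Import structures.
From mathcomp Require Import all_boot all_order all_algebra.
From mathcomp Require finmap.
From mathcomp Require Import all_classical all_reals all_analysis.
From mathcomp Require Import ess_sup_inf.

Set Implicit Arguments.
Unset Strict Implicit.
Unset Printing Implicit Defensive.

Import Order.TTheory GRing.Theory Num.Theory.
Import numFieldNormedType.Exports.

Local Open Scope classical_set_scope.
Local Open Scope ring_scope.

(* Edges are two-element sets of vertices, so loops and multiple edges are
   excluded by construction. *)
Record sgraph := SGraph {
  vertex :> finType;
  edge_set : {set {set vertex}};
  edge_card : forall e : {set vertex}, e \in edge_set -> #|e| = 2;
  edge_set_gt0 : (0 < #|edge_set|)%N
}.

Definition edge (G : sgraph) := {e : {set G} | e \in edge_set G}.

Lemma edge_has_ends (G : sgraph) (e : edge G) :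
  exists vw : G * G, val e == [set vw.1; vw.2]%SET.
Proof.
have /eqP/cards2P[v [w [_ ->]]] := edge_card (valP e).
by exists (v, w).
Qed.

(* The order in which the two ends are listed is an arbitrary choice;
   [measurementE] shows that the measurement map does not depend on it. *)
Definition edge_ends (G : sgraph) (e : edge G) : G * G :=
  xchoose (edge_has_ends e).

Section Flattenability.
Context {R : realType}.

Definition measurement (G : sgraph) (X : normedModType R) (x : G -> X) :
    {ffun edge G -> R} :=
  [ffun e => `|x (edge_ends e).1 - x (edge_ends e).2|].

Lemma measurementE (G : sgraph) (X : normedModType R) (x : G -> X)
    (e : edge G) (v w : G) :
  val e = [set v; w]%SET -> measurement x e = `|x v - x w|.
Proof.
move=> evw; rewrite ffunE.
have vNw : v != w.
  have := edge_card (valP e); rewrite evw cards2.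
  by case: (v == w).
have := eqP (xchooseP (edge_has_ends e)); rewrite -/(edge_ends e) evw.
case: (edge_ends e) => a b /= vwab.
have := finset.in_set2 a v w; rewrite vwab !inE eqxx /= => /esym/orP.
have := finset.in_set2 b v w; rewrite vwab !inE eqxx orbT /= => /esym/orP.
have aNb : a != b.
  by have := cards2 a b; rewrite -vwab cards2 vNw; case: (a == b).
move=> [] /eqP bE [] /eqP aE; rewrite aE bE ?eqxx // in aNb *.
by rewrite distrC.
Qed.

Definition flattenable (X Y : normedModType R) (G : sgraph) : Prop :=
  range (@measurement G Y) `<=` range (@measurement G X).

Definition nontrivial (X : lmodType R) : Prop := exists x : X, x != 0.

Definition finite_dimensional (X : lmodType R) : Prop :=
  exists (n : nat) (b : 'I_n -> X),
    forall x : X, exists c : 'I_n -> R, x = \sum_(i < n) c i *: b i.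

End Flattenability.

Section SequenceSpaces.
Context {R : realType}.
Local Open Scope ereal_scope.

(* Meant for 1 <= p <= +oo; the last branch is only relevant for p = +oo. *)
Definition seq_norm (p : \bar R) (x : nat -> R) : \bar R :=
  match p with
  | r%:E => (\sum_(k <oo) (`|x k| `^ r)%:E) `^ r^-1
  | _ => ereal_sup (range (fun k => `|x k|%:E))
  end.

Lemma counting_aeP (P : nat -> Prop) :
  (\forall k \ae @counting nat R, P k) -> forall k, P k.
Proof.
move=> [N [_ N0 PN]] k; apply: contrapT => nPk.
have Nk : [set k] `<=` N by move=> _ ->; exact: PN.
have : @counting nat R [set k] <= counting N.
  by apply: le_measure => //; rewrite inE.
by rewrite N0 /counting asboolT//= fset_set1 finmap.cardfs1 lee_fin ler10.
Qed.

Lemma counting_setT_gt0 : 0 < @counting nat R [set: nat].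
Proof. by rewrite /counting asboolF ?ltry//; exact: infinite_nat. Qed.

Lemma seq_normE (p : \bar R) (x : nat -> R) :
  1 <= p -> seq_norm p x = 'N[@counting nat R]_p[EFin \o x].
Proof.
case: p => [r|_|//] /=.
  by rewrite lee_fin => r1; rewrite Lnorm_counting ?(lt_le_trans ltr01).
rewrite unlock /Lnorm counting_setT_gt0; apply/eqP; rewrite eq_le.
apply/andP; split.
  apply: ge_ereal_sup => _ [k _ <-].
  exact: (counting_aeP (@ess_sup_ge _ _ _ (@counting nat R) _) k).
apply/ess_supP/nearW => k /=; apply: ereal_sup_ubound.
by exists k.
Qed.

Definition ell_pred (p : \bar R) : {pred nat -> R} :=
  [pred x | `[< seq_norm p x < +oo >]].

Record ell (p : \bar R) (p1 : 1 <= p) := Ell {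
  ell_seq :> nat -> R;
  _ : ell_seq \in ell_pred p
}.

Section EllNormed.
Context (p : \bar R) (p1 : 1 <= p).

Lemma ell_submod_closed : submod_closed (ell_pred p).
Proof.
have E x : (x \in ell_pred p) = (x \in Lfun (@counting nat R) p).
  by rewrite !inE /= [x \in mfun]mem_set ?andTb// seq_normE.
have [L0 LD] := @Lfun_submod_closed _ nat R (@counting nat R) p p1.
by split=> [|a x y]; rewrite !E; [exact: L0 | exact: LD].
Qed.

HB.instance Definition _ := GRing.isSubmodClosed.Build R (nat -> R)
  (ell_pred p) ell_submod_closed.

HB.instance Definition _ := [isSub for @ell_seq p p1].
HB.instance Definition _ := [Choice of ell p1 by <:].
HB.instance Definition _ := [SubChoice_isSubLmodule of ell p1 by <:].

Definition ell_norm (x : ell p1) : R := fine (seq_norm p x).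

Lemma seq_norm_fin_num (x : ell p1) : seq_norm p x \is a fin_num.
Proof.
rewrite fin_numElt; have /asboolP -> := valP x; rewrite andbT.
by rewrite seq_normE// (lt_le_trans ltNy0) ?Lnorm_ge0.
Qed.

Lemma ell_normE (x : ell p1) : (ell_norm x)%:E = seq_norm p x.
Proof. by rewrite fineK// seq_norm_fin_num. Qed.

Lemma ell_norm_triangle (x y : ell p1) :
  (ell_norm (x + y) <= ell_norm x + ell_norm y)%R.
Proof.
rewrite -lee_fin EFinD !ell_normE !seq_normE//.
exact: eminkowski.
Qed.

Lemma ell_in_Lfun (x : ell p1) : (x : nat -> R) \in Lfun (@counting nat R) p.
Proof.
rewrite !inE/=; apply/andP; split; first exact: mem_set.
by apply: mem_set; move/asboolP: (valP x); rewrite seq_normE.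
Qed.

Lemma ell_normZ (a : R) (x : ell p1) :
  ell_norm (a *: x) = (`|a| * ell_norm x)%R.
Proof.
apply: EFin_inj; rewrite EFinM !ell_normE !seq_normE//.
exact: (LnormZ (Lfun_Sub p1 (ell_in_Lfun x))).
Qed.

Lemma ell_norm_eq0 (x : ell p1) : ell_norm x = 0%R -> x = 0%R.
Proof.
move=> x0; have : seq_norm p x = 0 by rewrite -ell_normE x0.
rewrite seq_normE// => /Lnorm_eq0_eq0 x_ae0.
have {}x_ae0 : EFin \o x = \0 %[ae @counting nat R].
  by apply: x_ae0 => //; exact: lt_le_trans lte01 p1.
apply/val_inj/funext => k; apply: EFin_inj.
exact: (counting_aeP x_ae0 k I).
Qed.

HB.instance Definition _ := @Lmodule_isNormed.Build R (ell p1)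
  ell_norm ell_norm_triangle ell_normZ ell_norm_eq0.

Lemma ell_normrE (x : ell p1) : `|x|%:E = seq_norm p x.
Proof. exact: ell_normE. Qed.

End EllNormed.

End SequenceSpaces.

Notation ell_infty R := (@ell R +oo%E (leey 1%E)).
Notation ell_two R := (@ell R 2%:E (lee1n 2)).

(* Main.v *)
Require Import Defs.
From HB Require Import structures.
From mathcomp Require Import all_boot all_order all_fingroup all_algebra.
From mathcomp Require Import all_classical all_reals all_analysis.
From mathcomp Require Import ring lra.
Import Order.TTheory GRing.Theory Num.Theory.
Import numFieldNormedType.Exports.

(** Part (i) is the Fréchet embedding: a finite metric space sits isometrically
in l_infty through its distance functions ([frechet_embedding]).

Part (ii) combines two facts. First, if X is finite-dimensional, the set of
edge-length vectors realised in X is closed ([realization_of_approx]): after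
translating every connected component so that one chosen vertex is at the
origin, bounded edge lengths force a bounded placement, and compactness
applies. So it is enough to approximate the edge lengths of a placement in
l_2, and by truncation those of a finite set of points in Euclidean R^k.
Secondly, every infinite-dimensional Y contains almost isometric copies of
Euclidean R^k. This is Dvoretzky's theorem ([dvoretzky]), needed here
without any dimension estimate and only for finitely many points.

The embedding of R^k into Y is a random map a |-> sum_t <a,u_t> w_t, where the
u_t are drawn independently from a finite list of unit vectors and the w_t are
fixed vectors of Y. Three ingredients make it almost isometric up to scale.

- The w_t have a large mean norm E|sum_t +-w_t| >= 1, yet
  |sum_t b_t w_t|^2 <= eta sum_t b_t^2 with eta small
  ([flat_rademacher_family]). By the Dvoretzky--Rogers lemma
  ([dvoretzky_rogers]) there are arbitrarily many vectors e_j of norm at least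
  1/4 whose linear combinations have norm at most the Euclidean norm of the
  coefficients. Each e_j is repeated n times: then in one of the blocks all
  signs are likely to agree, so the mean norm of the signed sum is of order n,
  whereas the repetition multiplies the upper estimate by only sqrt n.

- The norm of the random sum concentrates: by the Efron--Stein inequality
  ([efron_stein]) and the convexity of the norm, its variance is at most
  4 eta for a unit vector a ([variance_norm_le]).

- The mean norm is nearly the same for all unit vectors a. For this the law of
  <a,u> has to be nearly independent of a when tested against Lipschitz
  functions ([sphere_design]). A list of unit vectors nearly minimising the
  energy sum_{u,v} (1+<u,v>)^N has nearly rotation invariant moments up to
  order N, since mixing it with a rotated copy of itself would otherwise lower
  the energy; Bernstein polynomials carry this from moments to Lipschitz
  functions.

A union bound over the finitely many differences of the given points then
selects one outcome of the random map. *)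

Set Implicit Arguments.
Unset Strict Implicit.
Unset Printing Implicit Defensive.
Local Open Scope classical_set_scope.
Local Open Scope ring_scope.

(** * Averages and the Efron--Stein inequality *)

Section Averages.
Context {R : realType}.

Definition avg (T : Type) (s : seq T) (f : T -> R) : R :=
  (size s)%:R^-1 * \sum_(u <- s) f u.

Lemma avg_ext (T : Type) (s : seq T) (f g : T -> R) :
  f =1 g -> avg s f = avg s g.
Proof. by move=> fg; congr (_ * _); apply: eq_bigr. Qed.

Lemma avgD (T : Type) (s : seq T) (f g : T -> R) :
  avg s (fun u => f u + g u) = avg s f + avg s g.
Proof. by rewrite /avg big_split /= mulrDr. Qed.

Lemma avgZ (T : Type) (s : seq T) (a : R) (f : T -> R) :
  avg s (fun u => a * f u) = a * avg s f.
Proof. by rewrite /avg -mulr_sumr mulrCA. Qed.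

Lemma avgB (T : Type) (s : seq T) (f g : T -> R) :
  avg s (fun u => f u - g u) = avg s f - avg s g.
Proof. by rewrite /avg sumrB mulrBr. Qed.

Lemma avg_sum (T I : Type) (s : seq T) (r : seq I) (F : I -> T -> R) :
  avg s (fun u => \sum_(i <- r) F i u) = \sum_(i <- r) avg s (F i).
Proof. by rewrite /avg exchange_big mulr_sumr. Qed.

Lemma avg_const (T : Type) (s : seq T) (a : R) :
  (0 < size s)%N -> avg s (fun=> a) = a.
Proof.
move=> s0; rewrite /avg big_const_seq count_predT iter_addr_0 -[a *+ _]mulr_natl.
by rewrite mulrA mulVf ?mul1r// pnatr_eq0 -lt0n.
Qed.

Lemma avg_map (T T' : Type) (s : seq T) (k : T -> T') (f : T' -> R) :
  avg (map k s) f = avg s (f \o k).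
Proof. by rewrite /avg big_map size_map. Qed.

Lemma avg_cat (T : Type) (s s' : seq T) (f : T -> R) :
  size s = size s' -> avg (s ++ s') f = 2^-1 * (avg s f + avg s' f).
Proof.
move=> ss'; rewrite /avg big_cat size_cat -ss' -mulrDr mulrA; congr (_ * _).
by rewrite -invfM -natrM mul2n addnn.
Qed.

Lemma avg_exchange (T T' : Type) (s : seq T) (s' : seq T') (f : T -> T' -> R) :
  avg s (fun u => avg s' (f u)) = avg s' (fun v => avg s (f ^~ v)).
Proof.
rewrite /avg -!mulr_sumr mulrCA; congr (_ * (_ * _)).
by rewrite exchange_big.
Qed.

Lemma ler_avg (T : eqType) (s : seq T) (f g : T -> R) :
  (forall u, u \in s -> f u <= g u) -> avg s f <= avg s g.
Proof.
move=> fg; rewrite ler_wpM2l ?invr_ge0//.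
by rewrite big_seq [leRHS]big_seq; apply: ler_sum.
Qed.

Lemma ler_norm_avg (T : Type) (s : seq T) (f : T -> R) :
  `|avg s f| <= avg s (fun u => `|f u|).
Proof.
rewrite normrM ger0_norm ?invr_ge0// ler_wpM2l ?invr_ge0//.
exact: ler_norm_sum.
Qed.

Lemma avg_sqr_le (T : eqType) (s : seq T) (f : T -> R) :
  (0 < size s)%N -> avg s f ^+ 2 <= avg s (fun u => f u ^+ 2).
Proof.
move=> s0; set c := avg s f.
have : 0 <= avg s (fun u => (f u - c) ^+ 2).
  by rewrite -(avg_const 0 s0); apply: ler_avg => u _; exact: sqr_ge0.
have -> : avg s (fun u => (f u - c) ^+ 2) =
    avg s (fun u => f u ^+ 2) - 2 * c * avg s f + c ^+ 2.
  rewrite -avgZ -avgB -[X in _ + X](avg_const (c ^+ 2) s0) -avgD.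
  by apply: avg_ext => u; ring.
by rewrite -/c; lra.
Qed.

(** Expectation of [f] over [m] independent uniform draws from [s]. Outcomes
are lists, so that inductions on [m] condition on the first draw. *)
Fixpoint iavg (T : Type) (m : nat) (s : seq T) (f : seq T -> R) : R :=
  if m is m'.+1 then avg s (fun u => iavg m' s (fun us => f (u :: us)))
  else f [::].

Lemma iavg_ext (T : Type) m (s : seq T) (f g : seq T -> R) :
  f =1 g -> iavg m s f = iavg m s g.
Proof.
elim: m f g => [|m IH] f g fg /=; first exact: fg.
by apply: avg_ext => u; apply: IH => us; exact: fg.
Qed.

Lemma iavgD (T : Type) m (s : seq T) (f g : seq T -> R) :
  iavg m s (fun us => f us + g us) = iavg m s f + iavg m s g.
Proof.
elim: m f g => [//|m IH] f g /=.
by rewrite -avgD; apply: avg_ext => u; exact: IH.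
Qed.

Lemma iavgB (T : Type) m (s : seq T) (f g : seq T -> R) :
  iavg m s (fun us => f us - g us) = iavg m s f - iavg m s g.
Proof.
elim: m f g => [//|m IH] f g /=.
by rewrite -avgB; apply: avg_ext => u; exact: IH.
Qed.

Lemma iavgZ (T : Type) m (s : seq T) a (f : seq T -> R) :
  iavg m s (fun us => a * f us) = a * iavg m s f.
Proof.
elim: m f => [//|m IH] f /=.
by rewrite -avgZ; apply: avg_ext => u; exact: IH.
Qed.

Lemma iavg_const (T : Type) m (s : seq T) a :
  (0 < size s)%N -> iavg m s (fun=> a) = a.
Proof.
move=> s0; elim: m => [//|m IH] /=.
by under avg_ext do rewrite IH; rewrite avg_const.
Qed.

Lemma iavg_sum (T I : Type) m (s : seq T) (r : seq I) (F : I -> seq T -> R) :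
  (0 < size s)%N ->
  iavg m s (fun us => \sum_(i <- r) F i us) = \sum_(i <- r) iavg m s (F i).
Proof.
move=> s0; elim: r => [|i r IH].
  by under iavg_ext do rewrite big_nil; rewrite big_nil iavg_const.
by under iavg_ext do rewrite big_cons; rewrite big_cons iavgD IH.
Qed.

Lemma ler_iavg (T : eqType) m (s : seq T) (f g : seq T -> R) :
  (forall us, size us = m -> {subset us <= s} -> f us <= g us) ->
  iavg m s f <= iavg m s g.
Proof.
elim: m f g => [|m IH] f g fg /=; first exact: fg.
apply: ler_avg => u us0; apply: IH => us sus uss; apply: fg; first by rewrite /= sus.
by move=> v; rewrite inE => /orP[/eqP ->//|/uss].
Qed.

Lemma iavg_sqr_le (T : eqType) m (s : seq T) (f : seq T -> R) :
  (0 < size s)%N -> iavg m s f ^+ 2 <= iavg m s (fun u => f u ^+ 2).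
Proof.
move=> s0; elim: m f => [//|m IH] f /=.
apply: (le_trans (avg_sqr_le _ s0)); apply: ler_avg => u _; exact: IH.
Qed.

Lemma avg_le_witness (T : eqType) (s : seq T) (f : T -> R) :
  (0 < size s)%N -> exists2 u, u \in s & f u <= avg s f.
Proof.
move=> s0; apply: contrapT => noP.
have lt u : u \in s -> avg s f < f u.
  by move=> us; rewrite ltNge; apply/negP => le; apply: noP; exists u.
have [u0 u0s] : exists u, u \in s.
  by case: (s) s0 => // u r _; exists u; rewrite mem_head.
have : 0 < avg s (fun u => f u - avg s f).
  rewrite mulr_gt0 ?invr_gt0 ?ltr0n// (big_rem u0)//= ltr_pwDl ?subr_gt0 ?lt//.
  rewrite big_seq sumr_ge0// => v /mem_rem vs.
  by rewrite subr_ge0 ltW// lt.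
by rewrite avgB avg_const// subrr ltxx.
Qed.

Lemma iavg_le_witness (T : eqType) m (s : seq T) (f : seq T -> R) :
  (0 < size s)%N ->
  exists us, [/\ size us = m, {subset us <= s} & f us <= iavg m s f].
Proof.
move=> s0; elim: m f => [|m IH] f /=; first by exists [::].
have [u us le1] := avg_le_witness (fun u => iavg m s (fun us => f (u :: us))) s0.
have [vs [sz sub le2]] := IH (fun us => f (u :: us)).
exists (u :: vs); split => /=; [by rewrite sz| |exact: le_trans le2 le1].
by move=> v; rewrite inE => /orP[/eqP ->//|/sub].
Qed.

Definition pos_part (x : R) := Num.max x 0.

Lemma pos_part_ge0 x : 0 <= pos_part x.
Proof. by rewrite le_max lexx orbT. Qed.

Lemma le_pos_part x : x <= pos_part x.
Proof. by rewrite le_max lexx. Qed.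

Lemma pos_part_sqrD x : pos_part x ^+ 2 + pos_part (- x) ^+ 2 = x ^+ 2.
Proof.
rewrite /pos_part; have [x0|x0] := leP x 0.
  by rewrite max_l ?oppr_ge0// sqrrN expr0n add0r.
by rewrite max_r ?oppr_le0 ?(ltW x0)// expr0n addr0.
Qed.

(** The variance is half the mean of (g u - g v)^2 over independent u and v;
by symmetry, keeping the positive part of the difference halves that mean. *)
Lemma avg_variance (T : eqType) (s : seq T) (g : T -> R) :
  (0 < size s)%N ->
  avg s (fun u => g u ^+ 2) - avg s g ^+ 2 =
  avg s (fun u => avg s (fun v => pos_part (g u - g v) ^+ 2)).
Proof.
move=> s0; set P := RHS.
have PE : P = avg s (fun u => avg s (fun v => pos_part (g v - g u) ^+ 2)).
  by rewrite /P avg_exchange.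
suff : 2 * (avg s (fun u => g u ^+ 2) - avg s g ^+ 2) = P + P by lra.
rewrite {2}PE -avgD.
transitivity (avg s (fun u => avg s (fun v => (g u - g v) ^+ 2))); last first.
  apply: avg_ext => u; rewrite -avgD; apply: avg_ext => v.
  by rewrite -(opprB (g u)) pos_part_sqrD.
set a := avg s g; set b := avg s (fun u => g u ^+ 2).
transitivity (avg s (fun u => g u ^+ 2 + (b - 2 * a * g u))).
  by rewrite avgD avgB avg_const// avgZ -/a -/b; ring.
apply: avg_ext => u.
rewrite -[X in X + _](avg_const (g u ^+ 2) s0) /b /a mulrAC -mulrA -!avgZ.
rewrite -avgB -avgD; apply: avg_ext => v; ring.
Qed.

(** The variance splits into the mean of the conditional variances given the
first draw, bounded inductively, and the variance of the conditional mean,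
bounded by Jensen's inequality. The positive parts matter for norms: convexity
controls how much resampling decreases a norm at a given outcome, not how much
it increases it. *)
Lemma efron_stein (T : eqType) (x0 : T) m (s : seq T) (f : seq T -> R) :
  (0 < size s)%N ->
  iavg m s (fun us => f us ^+ 2) - iavg m s f ^+ 2 <=
  iavg m s (fun us => \sum_(t < m)
     avg s (fun v => pos_part (f us - f (set_nth x0 us t v)) ^+ 2)).
Proof.
move=> s0; elim: m f => [|m IH] f; first by rewrite /= big_ord0; lra.
pose g u := iavg m s (fun us => f (u :: us)).
rewrite [X in X - _]/= [X in _ - X ^+ 2]/= -/g.
have -> : avg s (fun u => iavg m s (fun us => f (u :: us) ^+ 2)) =
  avg s (fun u => iavg m s (fun us => f (u :: us) ^+ 2) - g u ^+ 2) +
  avg s (fun u => g u ^+ 2) by rewrite -avgD; apply: avg_ext => u; ring.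
rewrite -addrA avg_variance// /= -avgD.
apply: ler_avg => u _.
apply: (@le_trans _ _ (iavg m s (fun us => \sum_(t < m)
     avg s (fun v => pos_part (f (u :: us) - f (u :: set_nth x0 us t v)) ^+ 2)) +
   iavg m s (fun us => avg s (fun v => pos_part (f (u :: us) - f (v :: us)) ^+ 2)))).
  apply: lerD; first exact: (IH (fun us => f (u :: us))).
  have exch (F : T -> seq T -> R) :
      iavg m s (fun us => avg s (F ^~ us)) = avg s (fun v => iavg m s (F v)).
    by rewrite iavgZ iavg_sum.
  rewrite (exch (fun v us => pos_part (f (u :: us) - f (v :: us)) ^+ 2)).
  apply: ler_avg => v _; rewrite /g -iavgB.
  apply: (le_trans _ (iavg_sqr_le _ _ s0)).
  rewrite ler_sqr ?nnegrE ?pos_part_ge0//; last first.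
    by rewrite -(iavg_const m 0 s0); apply: ler_iavg => *; exact: pos_part_ge0.
  rewrite {1}/pos_part ge_max; apply/andP; split.
    by apply: ler_iavg => *; exact: le_pos_part.
  by rewrite -(iavg_const m 0 s0); apply: ler_iavg => *; exact: pos_part_ge0.
rewrite -iavgD; apply: ler_iavg => us _ _.
by rewrite big_ord_recl /= addrC.
Qed.

End Averages.

(** * Mean norms of random sums *)

Section MeanNorm.
Context {R : realType} {Y : normedModType R}.
Implicit Types (w : nat -> Y) (x : Y) (cs ds : seq R).

Definition avgv (T : Type) (s : seq T) (X : T -> Y) : Y :=
  (size s)%:R^-1 *: \sum_(u <- s) X u.

Lemma avgvD (T : Type) (s : seq T) (X X' : T -> Y) :
  avgv s (fun u => X u + X' u) = avgv s X + avgv s X'.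
Proof. by rewrite /avgv big_split scalerDr. Qed.

Lemma avgv_const (T : Type) (s : seq T) x :
  (0 < size s)%N -> avgv s (fun=> x) = x.
Proof.
move=> s0; rewrite /avgv big_const_seq count_predT iter_addr_0 -[x *+ _]scaler_nat.
by rewrite scalerA mulVf ?scale1r// pnatr_eq0 -lt0n.
Qed.

Lemma avgv_scale (T : Type) (s : seq T) (f : T -> R) x :
  avgv s (fun u => f u *: x) = avg s f *: x.
Proof. by rewrite /avgv -scaler_suml scalerA. Qed.

Lemma norm_avgv_le (T : Type) (s : seq T) (X : T -> Y) :
  `|avgv s X| <= avg s (fun u => `|X u|).
Proof.
rewrite normrZ ger0_norm ?invr_ge0// ler_wpM2l ?invr_ge0//.
exact: ler_norm_sum.
Qed.

(** This is E|x + sum_(t < m) c_t w_t| for coefficients c_t drawn independently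
and uniformly from [cs]; see [iavg_normE]. *)
Fixpoint mean_norm (cs : seq R) (m : nat) (w : nat -> Y) (x : Y) : R :=
  if m is m'.+1 then
    avg cs (fun c => mean_norm cs m' (fun t => w t.+1) (x + c *: w 0))
  else `|x|.

Lemma iavg_normE (T : Type) (u0 : T) (s : seq T) (c : T -> R) m w x :
  iavg m s (fun us => `|x + \sum_(t < m) c (nth u0 us t) *: w t|) =
  mean_norm (map c s) m w x.
Proof.
elim: m w x => [|m IH] w x /=; first by rewrite big_ord0 addr0.
rewrite avg_map; apply: avg_ext => u /=; rewrite -IH; apply: iavg_ext => us.
by rewrite big_ord_recl /= addrA.
Qed.

Lemma mean_norm_lip cs m w x y : (0 < size cs)%N ->
  `|mean_norm cs m w x - mean_norm cs m w y| <= `|x - y|.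
Proof.
move=> cs0; elim: m w x y => [|m IH] w x y /=; first exact: ler_dist_dist.
rewrite -avgB (le_trans (ler_norm_avg _ _))//.
rewrite -[leRHS](avg_const _ cs0); apply: ler_avg => c _.
by apply: (le_trans (IH _ _ _)); rewrite opprD addrACA subrr addr0.
Qed.

(** Convexity: a mean of norms of translates is convex in the point that is
translated. *)
Lemma mean_norm_jensen (T : eqType) (s : seq T) (X : T -> Y) cs m w :
  (0 < size s)%N ->
  mean_norm cs m w (avgv s X) <= avg s (fun u => mean_norm cs m w (X u)).
Proof.
move=> s0; elim: m w X => [|m IH] w X /=; first exact: norm_avgv_le.
rewrite avg_exchange; apply: ler_avg => c _.
by apply: le_trans (IH _ _); rewrite avgvD avgv_const.
Qed.

Lemma norm_le_mean_norm cs m w x : (0 < size cs)%N ->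
  avg cs id = 0 -> `|x| <= mean_norm cs m w x.
Proof.
move=> cs0 csm; elim: m w x => [//|m IH] w x /=.
apply: (le_trans (IH (fun t => w t.+1) x)).
apply: le_trans (mean_norm_jensen _ _ _ _ cs0).
by rewrite avgvD avgv_const// avgv_scale csm scale0r addr0.
Qed.

(** For a symmetric law, c_t has the law of a random sign times |c_t|; by
convexity, |c_t| may be replaced by its mean, with the signs left random. *)
Lemma mean_norm_contraction cs m w x : (0 < size cs)%N ->
  (forall f : R -> R, avg cs (fun c => f (- c)) = avg cs f) ->
  mean_norm [:: 1; -1] m (fun t => avg cs Num.norm *: w t) x <= mean_norm cs m w x.
Proof.
move=> cs0 sym; set c := avg cs Num.norm; elim: m w x => [//|m IH] w x /=.
set w' := fun t => w t.+1; set G := mean_norm cs m w'.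
have -> : avg cs (fun b => G (x + b *: w 0)) =
    2^-1 * (avg cs (fun b => G (x + `|b| *: w 0)) +
            avg cs (fun b => G (x + (- `|b|) *: w 0))).
  rewrite -avgD -avgZ.
  transitivity (2^-1 * (avg cs (fun b => G (x + b *: w 0)) +
                        avg cs (fun b => G (x + (- b) *: w 0)))).
    by rewrite (sym (fun b => G (x + b *: w 0))); lra.
  rewrite -avgD -avgZ; apply: avg_ext => b; congr (_ * _).
  by case: (ger0P b) => _; rewrite // opprK addrC.
have J k : G (x + (k * c) *: w 0) <= avg cs (fun b => G (x + (k * `|b|) *: w 0)).
  apply: le_trans (mean_norm_jensen _ _ _ _ cs0).
  by rewrite avgvD avgv_const// avgv_scale avgZ.
have J1 := J 1; have J2 := J (-1).
rewrite !mul1r in J1; rewrite !mulN1r in J2.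
rewrite [X in X <= _]/avg big_cons big_seq1 /= scale1r scaleN1r -scaleNr.
apply: ler_wpM2l; first by rewrite invr_ge0.
apply: lerD.
  apply: le_trans (IH _ _) _; apply: le_trans J1 _.
  by apply: ler_avg => b _; rewrite mul1r.
apply: le_trans (IH _ _) _; apply: le_trans J2 _.
by apply: ler_avg => b _; rewrite mulN1r.
Qed.

Lemma mean_norm_scale cs (a : R) m w x : 0 <= a ->
  mean_norm cs m (fun t => a *: w t) (a *: x) = a * mean_norm cs m w x.
Proof.
move=> a0; elim: m w x => [|m IH] w x /=; first by rewrite normrZ ger0_norm.
rewrite -avgZ; apply: avg_ext => c.
by rewrite scalerA mulrC -scalerA -scalerDr IH.
Qed.

(** The two laws are exchanged one coefficient at a time: as a function of a
single coefficient, the mean norm over the others is 1-Lipschitz. *)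
Lemma mean_norm_compare cs ds m w x (e : R) :
  (0 < size cs)%N -> (0 < size ds)%N -> (forall t, (t < m)%N -> `|w t| <= 1) ->
  (forall h : R -> R, (forall c c', `|h c - h c'| <= `|c - c'|) ->
     `|avg cs h - avg ds h| <= e) ->
  `|mean_norm cs m w x - mean_norm ds m w x| <= m%:R * e.
Proof.
move=> cs0 ds0 w1 close; elim: m w w1 x => [|m IH] w w1 x /=.
  by rewrite subrr normr0 mul0r.
set w' := fun t => w t.+1.
pose g c := mean_norm cs m w' (x + c *: w 0).
pose g' c := mean_norm ds m w' (x + c *: w 0).
rewrite -/(g _) -/(g' _).
have -> : avg cs g - avg ds g' = (avg cs g - avg ds g) + avg ds (fun c => g c - g' c).
  by rewrite avgB addrA subrK.
rewrite (le_trans (ler_normD _ _))// -natr1 mulrDl mul1r addrC lerD//.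
  rewrite (le_trans (ler_norm_avg _ _))// -[leRHS](avg_const _ ds0).
  by apply: ler_avg => c _; apply: IH => t tm; exact: w1.
apply: close => c c'; rewrite /g (le_trans (mean_norm_lip _ _ _ _ cs0))//.
rewrite opprD addrACA subrr add0r -scalerBl normrZ.
by rewrite ler_piMr// w1.
Qed.

Local Notation rad := (mean_norm [:: 1; -1]).

Lemma radS m w x :
  rad m.+1 w x = 2^-1 * (rad m (fun t => w t.+1) (x + w 0) +
                         rad m (fun t => w t.+1) (x - w 0)).
Proof.
by rewrite /= /avg !big_cons big_nil addr0 scale1r scaleN1r.
Qed.

Lemma norm_le_rad m w x : `|x| <= rad m w x.
Proof.
apply: norm_le_mean_norm => //.
by rewrite /avg !big_cons big_nil addr0 subrr mulr0.
Qed.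

Lemma rad_lower (n m : nat) w x (L : R) :
  (forall z, L <= rad m (fun t => w (n + t)%N) z) -> L <= rad (n + m) w x.
Proof.
elim: n w x => [|n IH] w x lL; first exact: lL.
rewrite addSn radS.
have := IH (fun t => w t.+1) (x + w 0) lL.
have := IH (fun t => w t.+1) (x - w 0) lL.
by lra.
Qed.

Lemma addv_iter x (v : Y) n : x + v + n%:R *: v = x + n.+1%:R *: v.
Proof. by rewrite -addrA -{1}[v]scale1r -scalerDl nat1r. Qed.

(** The first [n] signs all equal the prescribed one with probability 2^-n; on
the other outcomes the later vectors alone provide the lower bound [L]. *)
Lemma rad_run (n m : nat) w x (e : Y) (L : R) (b : bool) :
  (forall t, (t < n)%N -> w t = e) ->
  (forall z, L <= rad m (fun t => w (n + t)%N) z) ->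
  2^-1 ^+ n * rad m (fun t => w (n + t)%N) (x + n%:R *: ((-1) ^+ b *: e)) +
    (1 - 2^-1 ^+ n) * L <= rad (n + m) w x.
Proof.
elim: n w x => [|n IH] w x we lL.
  by rewrite expr0 mul1r subrr mul0r addr0 scale0r addr0.
have h t : (t < n)%N -> w t.+1 = e by move=> tn; exact: we.
have lowp := rad_lower (w := fun t => w t.+1) (x + w 0) lL.
have lowm := rad_lower (w := fun t => w t.+1) (x - w 0) lL.
have IHb := IH (fun t => w t.+1) (x + (-1) ^+ b *: e) h lL.
rewrite addv_iter in IHb.
rewrite addSn radS exprS.
have -> : w 0 = e by exact: we.
rewrite (we 0)// in lowp lowm.
set K := rad m (fun t : nat => w (n.+1 + t)%N) in IHb *.
case: b {IH} IHb => /=; rewrite ?expr1 ?expr0 ?scale1r ?scaleN1r; lra.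
Qed.

(** With probability 2^-n the n+1 signs of the block agree. The two possible
sums x + (n+1)e and x - (n+1)e then have norms adding up to at least
2(n+1)|e|, whatever x is. *)
Lemma rad_block (n m : nat) w x (e : Y) (c L : R) :
  (forall t, (t < n.+1)%N -> w t = e) -> c <= `|e| ->
  (forall z, L <= rad m (fun t => w (n.+1 + t)%N) z) ->
  2^-1 ^+ n * (n.+1%:R * c) + (1 - 2^-1 ^+ n) * L <= rad (n.+1 + m) w x.
Proof.
move=> we ce lL.
have h t : (t < n)%N -> w t.+1 = e by move=> tn; exact: we.
have p := rad_run (w := fun t => w t.+1) (x + e) false h lL.
have q := rad_run (w := fun t => w t.+1) (x - e) true h lL.
rewrite addSn radS we//.
rewrite expr0 scale1r addv_iter in p.
rewrite expr1 scaleN1r addv_iter in q.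
set K := rad m _ in lL p q *.
have sumK : 2 * (n.+1%:R * c) <= K (x + n.+1%:R *: e) + K (x + n.+1%:R *: - e).
  have tri : `|(x + n.+1%:R *: e) - (x + n.+1%:R *: - e)| = 2 * (n.+1%:R * `|e|).
    rewrite opprD addrACA subrr add0r scalerN opprK -scalerDl normrZ.
    by rewrite ger0_norm ?addr_ge0//; ring.
  apply: (@le_trans _ _ (2 * (n.+1%:R * `|e|))); first by rewrite !ler_wpM2l.
  rewrite -tri (le_trans (ler_normB _ _))//.
  by apply: lerD; exact: norm_le_rad.
have : 2^-1 ^+ n * (2 * (n.+1%:R * c)) <=
       2^-1 ^+ n * (K (x + n.+1%:R *: e) + K (x + n.+1%:R *: - e)).
  by rewrite ler_wpM2l// exprn_ge0// invr_ge0.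
by lra.
Qed.

(** The sequence of vectors consists of [M] blocks, the j-th repeating [e j]
n+1 times. The factor 1 - (1 - 2^-n)^M is the probability that the signs agree
in at least one block. *)
Lemma rad_growth (n M : nat) (e : nat -> Y) x (c : R) :
  (forall j, (j < M)%N -> c <= `|e j|) ->
  n.+1%:R * c * (1 - (1 - 2^-1 ^+ n) ^+ M) <=
    rad (M * n.+1) (fun t => e (t %/ n.+1)%N) x.
Proof.
elim: M e x => [|M IH] e x ce.
  by rewrite expr0 subrr mulr0 normr_ge0.
rewrite mulSn; set L := n.+1%:R * c * (1 - (1 - 2^-1 ^+ n) ^+ M).
have lL z : L <= rad (M * n.+1) (fun t => e ((n.+1 + t) %/ n.+1)%N) z.
  have -> : (fun t => e ((n.+1 + t) %/ n.+1)%N) = (fun t => e (t %/ n.+1).+1).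
    by apply/funext => t; rewrite -{1}[n.+1]mul1n divnMDl// add1n.
  by apply: (IH (fun j => e j.+1)) => j jM; exact: ce.
apply: le_trans (rad_block x (e := e 0) (c := c) _ _ lL).
- rewrite le_eqVlt; apply/orP; left; apply/eqP; rewrite /L exprS; ring.
- by move=> t tn; rewrite divn_small.
- exact: ce.
Qed.

Lemma expr_compl_le (q : R) M : 0 <= q <= 1 -> (1 + M%:R * q) * (1 - q) ^+ M <= 1.
Proof.
move=> /andP[q0 q1]; elim: M => [|M IH]; first by rewrite mul0r addr0 mul1r.
apply: le_trans IH; rewrite exprS mulrA ler_wpM2r ?exprn_ge0 ?subr_ge0//.
rewrite -natr1.
have : 0 <= M%:R * (q * q) by rewrite !mulr_ge0.
have : 0 <= q * q by rewrite mulr_ge0.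
by lra.
Qed.

(** With 2^n blocks the signs agree in some block with probability at least
1/2, by Bernoulli's inequality. *)
Lemma rad_repeat_ge (n : nat) (e : nat -> Y) (c : R) : 0 <= c ->
  (forall j, (j < 2 ^ n)%N -> c <= `|e j|) ->
  n.+1%:R * c / 2 <= rad (2 ^ n * n.+1) (fun t => e (t %/ n.+1)%N) 0.
Proof.
move=> c0 ce; apply: le_trans (rad_growth _ _ ce).
rewrite ler_wpM2l ?mulr_ge0//.
have p0 : (2 : R) ^+ n != 0 by rewrite expf_neq0 ?pnatr_eq0.
have := @expr_compl_le (2^-1 ^+ n) (2 ^ n).
rewrite natrX -exprMn divff// expr1n.
rewrite exprn_ge0 ?invr_ge0// exprn_ile1 ?invr_ge0 ?invf_le1 ?ler1n//.
by move=> /(_ isT); lra.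
Qed.

End MeanNorm.

Section Sqr.
Context {R : realType} {Y : normedModType R}.

(** Cauchy--Schwarz within each block. *)
Lemma repeat_upper2 (n M : nat) (e : nat -> Y) :
  (forall b : nat -> R,
     `|\sum_(j < M) b j *: e j| ^+ 2 <= \sum_(j < M) b j ^+ 2) ->
  forall b : nat -> R,
    `|\sum_(t < M * n.+1) b t *: e (t %/ n.+1)%N| ^+ 2 <=
    n.+1%:R * \sum_(t < M * n.+1) b t ^+ 2.
Proof.
move=> e2 b.
have split (V : zmodType) (F : nat -> V) : \sum_(t < M * n.+1) F t =
    \sum_(j < M) \sum_(i < n.+1) F (j * n.+1 + i)%N.
  elim: (M) => [|M' IH]; first by rewrite mul0n !big_ord0.
  by rewrite [in RHS]big_ord_recr /= -IH mulSn addnC big_split_ord.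
rewrite (split _ (fun t => b t *: e (t %/ n.+1)%N)) (split _ (fun t => b t ^+ 2)).
under eq_bigr => j _.
  under eq_bigr => i _ do rewrite divnMDl// divn_small// addn0.
  rewrite -scaler_suml.
  over.
apply: (le_trans (e2 (fun j => \sum_(i < n.+1) b (j * n.+1 + i)%N))).
rewrite mulr_sumr; apply: ler_sum => j _.
have := @avg_sqr_le R _ (enum 'I_n.+1) (fun i => b (j * n.+1 + i)%N).
rewrite /avg -!big_enum /= size_enum_ord => /(_ isT).
set S := \sum_(i <- _) _; set Q := \sum_(i <- _) _.
have n0 : n.+1%:R != 0 :> R by rewrite pnatr_eq0.
move=> le; have : n.+1%:R ^+ 2 * (n.+1%:R^-1 * S) ^+ 2 <= n.+1%:R ^+ 2 * (n.+1%:R^-1 * Q).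
  by rewrite ler_wpM2l// exprn_ge0.
by rewrite -exprMn mulVKf// expr2 -mulrA mulVKf.
Qed.

(** Let delta_tv be the decrease of |z| when d_tv w_t is subtracted. By
convexity, subtracting all of them with the small weights tau delta_tv
decreases the norm by at least tau sum delta_tv^2; the upper estimate on
combinations of the w_t caps that decrease by a multiple of
tau sqrt(sum delta_tv^2). Comparing the two bounds sum delta_tv^2. This plays the
role of a norming functional at z. *)
Lemma sum_sqr_decrease_le (T : eqType) (s : seq T) (m : nat) (w : nat -> Y)
    (z : Y) (d : nat -> T -> R) (D eta : R) :
  (0 < size s)%N ->
  (forall t v, v \in s -> d t v ^+ 2 <= D) ->
  (forall b : nat -> R,
     `|\sum_(t < m) b t *: w t| ^+ 2 <= eta * \sum_(t < m) b t ^+ 2) ->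
  0 <= eta -> 
  \sum_(t < m) avg s (fun v => pos_part (`|z| - `|z - d t v *: w t|) ^+ 2) <= D * eta.
Proof.
move=> s0 dD w2 eta0; pose delta t v := pos_part (`|z| - `|z - d t v *: w t|).
rewrite -/(delta _ _); set Q := leLHS.
have D0 : 0 <= D.
  by case: (s) s0 dD => // u r _ /(_ 0%N u (mem_head _ _)); apply: le_trans; exact: sqr_ge0.
have delta0 t v : 0 <= delta t v by exact: pos_part_ge0.
have avg_ge0 (f : T -> R) : (forall v, 0 <= f v) -> 0 <= avg s f.
  by move=> f0; rewrite -(avg_const 0 s0); apply: ler_avg => v _.
have Q0 : 0 <= Q by apply: sumr_ge0 => t _; apply: avg_ge0 => v; exact: sqr_ge0.
pose S := \sum_(t < m) avg s (delta t).
have S0 : 0 <= S by apply: sumr_ge0 => t _; apply: avg_ge0.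
(* With this factor the total weight tau * S stays below 1, so that the
   weighted subtraction below is a convex combination. *)
pose tau := (1 + S)^-1.
have tau0 : 0 < tau by rewrite invr_gt0; lra.
have tauS : tau * S <= 1 by rewrite mulrC ler_pdivrMr; lra.
pose y := z - \sum_(t < m) avg s (fun v => tau * delta t v * d t v) *: w t.
have upper : `|y| <= `|z| - tau * Q.
  have -> : y = (1 - tau * S) *: z +
      \sum_(t < m) avgv s (fun v => (tau * delta t v) *: (z - d t v *: w t)).
    rewrite scalerBl scale1r /y -addrA; congr (_ + _).
    rewrite /S mulr_sumr scaler_suml -!sumrN -big_split; apply: eq_bigr => t _ /=.
    rewrite -avgZ -!avgv_scale -[in RHS]scaleN1r -[in LHS]scaleN1r.
    rewrite /avgv ![_ *: (_ *: \sum_(_ <- _) _)]scalerA ![_ * _^-1]mulrC -!scalerA.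
    rewrite -scalerDr; congr (_ *: _); rewrite !scaler_sumr -big_split /=.
    by apply: eq_bigr => v _; rewrite !scaleN1r scalerBr addKr scalerA.
  apply: (le_trans (ler_normD _ _)).
  rewrite normrZ ger0_norm ?subr_ge0//.
  suff : `|\sum_(t < m) avgv s (fun v => (tau * delta t v) *: (z - d t v *: w t))|
     <= tau * S * `|z| - tau * Q by lra.
  apply: (le_trans (ler_norm_sum _ _ _)).
  rewrite /S /Q !mulr_sumr mulr_suml -sumrB; apply: ler_sum => t _.
  apply: (le_trans (norm_avgv_le _ _)).
  rewrite mulrAC -!avgZ -avgB; apply: ler_avg => v _.
  rewrite normrZ ger0_norm ?mulr_ge0 ?(ltW tau0)//.
  have -> : tau * `|z| * delta t v - tau * delta t v ^+ 2 =
    tau * (delta t v * (`|z| - delta t v)) by ring.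
  rewrite -mulrA ler_pM2l//.
  rewrite /delta /pos_part; case: (leP (`|z| - `|z - d t v *: w t|) 0) => _.
    by rewrite !mul0r.
  by rewrite subKr.
have lower : `|z| - `|\sum_(t < m) avg s (fun v => tau * delta t v * d t v) *: w t| <= `|y|.
  exact: lerB_dist.
set W := \sum_(t < m) _ in lower.
have W2 : `|W| ^+ 2 <= eta * (D * tau ^+ 2 * Q).
  apply: (le_trans (w2 (fun t => avg s (fun v => tau * delta t v * d t v)))).
  rewrite ler_wpM2l// mulr_sumr; apply: ler_sum => t _.
  apply: (le_trans (avg_sqr_le _ s0)); rewrite -avgZ; apply: ler_avg => v vs.
  rewrite exprMn mulrC exprMn mulrA ler_wpM2r ?sqr_ge0//.
  by rewrite ler_wpM2r ?sqr_ge0// dD.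
have : (tau * Q) ^+ 2 <= `|W| ^+ 2.
  by rewrite ler_sqr ?nnegrE ?mulr_ge0 ?(ltW tau0)//; lra.
move=> /le_trans/(_ W2).
have [->|Qn0] := eqVneq Q 0; first by rewrite mulr_ge0.
have Qp : 0 < Q by rewrite lt_neqAle eq_sym Qn0.
have -> : (tau * Q) ^+ 2 = (tau ^+ 2 * Q) * Q by ring.
have -> : eta * (D * tau ^+ 2 * Q) = (tau ^+ 2 * Q) * (D * eta) by ring.
by rewrite ler_pM2l// mulr_gt0// exprn_gt0.
Qed.

(** Resampling the t-th draw subtracts a multiple of w_t, so the Efron--Stein
sum is pointwise a sum of squared decreases of a norm. *)
Lemma variance_norm_le (T : eqType) (s : seq T) (u0 : T) (m : nat)
    (w : nat -> Y) (x : Y) (c : T -> R) (D eta : R) :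
  (0 < size s)%N ->
  {in s &, forall u v, (c u - c v) ^+ 2 <= D} ->
  (forall b : nat -> R,
     `|\sum_(t < m) b t *: w t| ^+ 2 <= eta * \sum_(t < m) b t ^+ 2) ->
  0 <= eta ->
  let f us := `|x + \sum_(t < m) c (nth u0 us t) *: w t| in
  iavg m s (fun us => f us ^+ 2) - iavg m s f ^+ 2 <= D * eta.
Proof.
move=> s0 cD w2 eta0; set f := fun us => _.
apply: (le_trans (efron_stein u0 _ _ s0)).
rewrite -[leRHS](iavg_const m _ s0); apply: ler_iavg => us sz sub.
pose z := x + \sum_(t < m) c (nth u0 us t) *: w t.
pose d t v := c (nth u0 us t) - c v.
apply: le_trans (_ : \sum_(t < m) avg s (fun v => pos_part (`|z| - `|z - d t v *: w t|) ^+ 2) <= _).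
  apply: ler_sum => t _; apply: ler_avg => v vs; rewrite le_eqVlt; apply/orP; left.
  apply/eqP; congr (pos_part (_ - `|_|) ^+ 2).
  rewrite /z -addrA; congr (_ + _).
  rewrite (bigD1 t)//= [in RHS](bigD1 t)//= nth_set_nth /= eqxx.
  have swap (a b r : Y) : a + r - (a - b) = b + r by rewrite opprB addrC addrA subrK.
  rewrite /d scalerBl swap; congr (_ + _).
  by apply: eq_bigr => i it; rewrite nth_set_nth /= (inj_eq val_inj) (negbTE it).
(* Beyond the length of [us] the default [u0] need not lie in [s]. *)
pose d' t v := if (t < m)%N then d t v else 0.
have -> : \sum_(t < m) avg s (fun v => pos_part (`|z| - `|z - d t v *: w t|) ^+ 2) =
    \sum_(t < m) avg s (fun v => pos_part (`|z| - `|z - d' t v *: w t|) ^+ 2).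
  by apply: eq_bigr => t _; rewrite /d' ltn_ord.
apply: sum_sqr_decrease_le => // t v vs; rewrite /d'; case: ifP => tm.
  by apply: cD => //; apply/sub/mem_nth; rewrite sz.
case: (s) s0 cD => // a r _ /(_ a a (mem_head _ _) (mem_head _ _)).
by rewrite subrr.
Qed.

End Sqr.

(** * Nearly rotation invariant measures on the sphere *)

Section Dot.
Context {R : realType} {k : nat}.
Implicit Types (u v a b n : 'rV[R]_k) (c : R).

Definition dot u v : R := \sum_i u 0 i * v 0 i.

Lemma dotC u v : dot u v = dot v u.
Proof. by apply: eq_bigr => i _; rewrite mulrC. Qed.

Lemma dotDl u v a : dot (u + v) a = dot u a + dot v a.
Proof. by rewrite /dot -big_split; apply: eq_bigr => i _; rewrite mxE mulrDl. Qed.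

Lemma dotZl c u v : dot (c *: u) v = c * dot u v.
Proof. by rewrite /dot mulr_sumr; apply: eq_bigr => i _; rewrite mxE mulrA. Qed.

Lemma dotNl u v : dot (- u) v = - dot u v.
Proof. by rewrite -scaleN1r dotZl mulN1r. Qed.

Lemma dotDr u v a : dot a (u + v) = dot a u + dot a v.
Proof. by rewrite !(dotC a) dotDl. Qed.

Lemma dotZr c u v : dot v (c *: u) = c * dot v u.
Proof. by rewrite !(dotC v) dotZl. Qed.

Lemma dotNr u v : dot v (- u) = - dot v u.
Proof. by rewrite !(dotC v) dotNl. Qed.

Lemma dot_ge0 u : 0 <= dot u u.
Proof. by apply: sumr_ge0 => i _; rewrite -expr2 sqr_ge0. Qed.

Lemma dot_eq0 u : dot u u = 0 -> u = 0.
Proof.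
move=> /eqP; rewrite psumr_eq0; last by move=> i _; rewrite -expr2 sqr_ge0.
move=> /allP u0; apply/rowP => i; rewrite mxE.
by have := u0 i (mem_index_enum _); rewrite -expr2 sqrf_eq0 => /eqP.
Qed.

Lemma dot_unit_le1 u v : dot u u = 1 -> dot v v = 1 -> `|dot u v| <= 1.
Proof.
move=> u1 v1; rewrite ler_norml.
have := dot_ge0 (u - v); have := dot_ge0 (u + v).
rewrite !(dotDl, dotDr, dotNl, dotNr) u1 v1 (dotC v u).
by lra.
Qed.

Lemma dot_delta (i : 'I_k) b : dot (delta_mx 0 i) b = b 0 i.
Proof.
rewrite /dot (bigD1 i)//= big1 ?addr0 => [|j ji].
  by rewrite mxE !eqxx mul1r.
by rewrite mxE (negbTE ji) andbF mul0r.
Qed.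

Lemma coord_sqr_le_dot b i : b 0 i ^+ 2 <= dot b b.
Proof.
rewrite /dot (bigD1 i)//= expr2 lerDl.
by apply: sumr_ge0 => j _; rewrite -expr2 sqr_ge0.
Qed.

Lemma unit_coord_le1 u i : dot u u = 1 -> `|u 0 i| <= 1.
Proof.
move=> u1; rewrite -(@ler_sqr _ _ 1) ?nnegrE// expr1n real_normK ?num_real//.
rewrite -u1.
exact: coord_sqr_le_dot.
Qed.

(** Reflection in the hyperplane orthogonal to [n]; the identity if n = 0. *)
Definition refl n u := u - (2 * dot n u / dot n n) *: n.

Lemma refl_isometry n u v : dot (refl n u) (refl n v) = dot u v.
Proof.
rewrite /refl; have [n0|n0] := eqVneq (dot n n) 0.
  by rewrite (dot_eq0 n0) !scaler0 !subr0.
rewrite !(dotDl, dotDr, dotNl, dotNr, dotZl, dotZr) (dotC u n).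
by field.
Qed.

Lemma reflK n : involutive (refl n).
Proof.
move=> u; rewrite /refl; have [n0|n0] := eqVneq (dot n n) 0.
  by rewrite (dot_eq0 n0) !scaler0 !subr0.
rewrite !(dotDr, dotNr, dotZr) -addrA -opprD -scalerDl.
set c := (X in _ - X *: _); suff -> : c = 0 by rewrite scale0r subr0.
by rewrite /c; field.
Qed.

Lemma refl_swap a b : dot a a = dot b b -> refl (a - b) a = b.
Proof.
move=> ab; rewrite /refl; have [n0|n0] := eqVneq (dot (a - b) (a - b)) 0.
  have /eqP := dot_eq0 n0; rewrite subr_eq0 => /eqP ->.
  by rewrite subrr scaler0 subr0.
have -> : 2 * dot (a - b) a / dot (a - b) (a - b) = 1.
  apply: (mulIf n0); rewrite mulfVK// mul1r.
  rewrite !(dotDl, dotDr, dotNl, dotNr) -ab (dotC b a); ring.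
by rewrite scale1r subKr.
Qed.

Lemma refl_dot n u v : dot (refl n u) v = dot u (refl n v).
Proof. by rewrite -{2}[u](reflK n) refl_isometry. Qed.

End Dot.

Section Energy.
Context {R : realType} (k N : nat).
Implicit Types (u v : 'rV[R]_k) (s : seq 'rV[R]_k).

(** Coordinates of the vector (1, u). Monomials of length exactly N in them are
all the monomials of degree at most N in u. *)
Definition affine u (i : 'I_k.+1) : R :=
  if unlift ord0 i is Some j then u 0 j else 1.

Definition monomial (f : {ffun 'I_N -> 'I_k.+1}) u := \prod_t affine u (f t).

Lemma sum_affine (l : 'I_k.+1 -> R) u :
  \sum_i l i * affine u i = l ord0 + \sum_j l (lift ord0 j) * u 0 j.
Proof.
rewrite big_ord_recl /affine unlift_none mulr1; congr (_ + _).
by apply: eq_bigr => j _; rewrite liftK.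
Qed.

Lemma prod_affine (l : 'I_N -> 'I_k.+1 -> R) u :
  \prod_t (\sum_i l t i * affine u i) =
  \sum_(f : {ffun 'I_N -> 'I_k.+1}) (\prod_t l t (f t)) * monomial f u.
Proof. by rewrite bigA_distr_bigA; apply: eq_bigr => f _; rewrite big_split. Qed.

(** The monomials are a feature map of the kernel (1 + <u,v>)^N. *)
Lemma sum_monomial u v :
  \sum_f monomial f u * monomial f v = (1 + dot u v) ^+ N.
Proof.
rewrite -(prod_affine (fun _ => affine u)) sum_affine prodr_const card_ord.
congr ((_ + _) ^+ _); first by rewrite /affine unlift_none.
by apply: eq_bigr => j _; rewrite /affine liftK.
Qed.

(** The squared norm of the mean feature vector. By [energyE] it is a mean of a
kernel that depends only on inner products, hence is invariant under
isometries. *)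
Definition energy s := \sum_f avg s (monomial f) ^+ 2.

Lemma energyE s : energy s = avg s (fun u => avg s (fun v => (1 + dot u v) ^+ N)).
Proof.
under [RHS]avg_ext => u.
  under avg_ext => v do rewrite -sum_monomial.
  rewrite avg_sum.
  over.
rewrite avg_sum; apply: eq_bigr => f _; rewrite expr2 -avgZ.
by apply: avg_ext => u; rewrite avgZ mulrC.
Qed.

Lemma energy_isometry (H : 'rV[R]_k -> 'rV[R]_k) s :
  (forall u v, dot (H u) (H v) = dot u v) -> energy (map H s) = energy s.
Proof.
move=> iso; rewrite !energyE avg_map; apply: avg_ext => u /=.
by rewrite avg_map; apply: avg_ext => v /=; rewrite iso.
Qed.

(** Take [s] within g^2/4 of the least energy. An isometric copy of [s] has the
same energy, and the mixture of [s] with it cannot go below the infimum; by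
the parallelogram identity the mean feature vectors of [s] and of the copy are
within g of each other. *)
Lemma near_invariant_monomials (g : R) : (0 < k)%N -> 0 < g ->
  exists s, [/\ (0 < size s)%N, forall u, u \in s -> dot u u = 1 &
    forall H : 'rV[R]_k -> 'rV[R]_k,
      (forall u v, dot (H u) (H v) = dot u v) ->
      forall f, `|avg s (monomial f) - avg s (monomial f \o H)| <= g].
Proof.
move=> k0 g0.
pose unit_list s := (0 < size s)%N /\ forall u, u \in s -> dot u u = 1.
pose E : set R := [set energy s | s in [set s | unit_list s]]%classic.
have E_inf : has_inf E.
  split; last by exists 0 => _ [s _ <-]; apply: sumr_ge0 => f _; exact: sqr_ge0.
  exists (energy [:: delta_mx 0 (Ordinal k0)]); exists [:: delta_mx 0 (Ordinal k0)] => //.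
  split=> // u; rewrite inE => /eqP ->.
  by rewrite dot_delta mxE !eqxx.
have d0 : 0 < g ^+ 2 / 4 by rewrite divr_gt0// exprn_gt0.
have [_ [s [s0 s1] <-] near] := inf_adherent d0 E_inf.
exists s; split=> // H iso f.
have mixed : inf E <= energy (s ++ map H s).
  apply: ge_inf; first exact: E_inf.2.
  exists (s ++ map H s) => //; split; first by rewrite size_cat ltn_addr.
  move=> u; rewrite mem_cat => /orP[/s1//|/mapP[v vs ->]].
  by rewrite iso s1.
rewrite -(@ler_sqr _ _ g) ?nnegrE ?(ltW g0)// real_normK ?num_real//.
pose A f := avg s (monomial f); pose B f := avg (map H s) (monomial f).
have Bf : avg s (monomial f \o H) = B f by rewrite /B avg_map.
rewrite Bf -/(A f).
have total : \sum_f (A f - B f) ^+ 2 = 4 * energy s - 4 * energy (s ++ map H s).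
  transitivity (2 * energy s + 2 * energy (map H s) - 4 * energy (s ++ map H s)).
    rewrite /energy !mulr_sumr -big_split -sumrB; apply: eq_bigr => h _ /=.
    rewrite avg_cat ?size_map// -/(A h) -/(B h); lra.
  by rewrite (energy_isometry s iso); ring.
apply: (@le_trans _ _ (\sum_f (A f - B f) ^+ 2)).
  by rewrite (bigD1 f)//= lerDl sumr_ge0// => h _; exact: sqr_ge0.
by rewrite total; lra.
Qed.

End Energy.

(** A reflection carries a to b. The moments are combinations of the monomials
with coefficients bounded by 1, each of which is nearly invariant. *)
Lemma near_invariant_moments {R : realType} (k N : nat) (e : R) : 0 < e ->
  exists s : seq 'rV[R]_k.+1,
    [/\ (0 < size s)%N, forall u, u \in s -> dot u u = 1 &
    forall a b, dot a a = 1 -> dot b b = 1 -> forall r, (r <= N)%N ->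
      `|avg s (fun u => ((1 + dot a u) / 2) ^+ r) -
        avg s (fun u => ((1 + dot b u) / 2) ^+ r)| <= e].
Proof.
move=> e0; pose C : R := #|{ffun 'I_N -> 'I_k.+2}|%:R.
have C0 : 0 < C by rewrite ltr0n; apply/card_gt0P; exists [ffun=> ord0].
have [|s [s0 s1 inv]] := @near_invariant_monomials R k.+1 N (e / C) isT.
  by rewrite divr_gt0.
exists s; split=> // a b a1 b1 r rN.
pose H := refl (b - a).
have Hab u : dot b u = dot a (H u).
  rewrite -refl_dot; have := reflK (b - a) b.
  by rewrite (refl_swap (etrans b1 (esym a1))) => ->.
(* The r-th power as a product of N affine forms, padded by the form 1. *)
pose l (t : 'I_N) (i : 'I_k.+2) : R :=
  if (t < r)%N then affine a i / 2 else (i == ord0)%:R.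
have l1 t i : `|l t i| <= 1.
  rewrite /l; case: ifP => _; last by case: (_ == _); rewrite ?normr1 ?normr0.
  rewrite normrM [`|2^-1|]ger0_norm ?invr_ge0// /affine.
  case: unliftP => [j _|_]; last by rewrite normr1; lra.
  by have := unit_coord_le1 j a1; lra.
have powE u : ((1 + dot a u) / 2) ^+ r =
    \sum_(f : {ffun 'I_N -> 'I_k.+2}) (\prod_t l t (f t)) * monomial f u.
  rewrite -prod_affine (bigID (fun t : 'I_N => (t < r)%N))/= [X in _ = _ * X]big1 => [|t tr].
    rewrite mulr1.
    transitivity (\prod_(t < N | (t < r)%N) ((1 + dot a u) / 2)).
      rewrite -(big_ord_widen _ (fun=> (1 + dot a u) / 2))//.
      by rewrite prodr_const card_ord.
    apply: eq_bigr => t tr; rewrite sum_affine /l tr {1}/affine unlift_none.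
    rewrite mulrDl; congr (_ + _); rewrite /dot mulr_suml.
    by apply: eq_bigr => j _; rewrite /affine liftK mulrAC.
  rewrite sum_affine /l (negbTE tr) eqxx big1 ?addr0// => j _.
  by rewrite eq_sym (negbTE (neq_lift _ _)) mul0r.
under [X in X - _]avg_ext do rewrite powE.
under [X in _ - X]avg_ext do rewrite Hab powE.
rewrite !avg_sum -sumrB (le_trans (ler_norm_sum _ _ _))//.
have -> : e = \sum_(f : {ffun 'I_N -> 'I_k.+2}) (e / C).
  by rewrite sumr_const -[_ *+ _]mulr_natr divfK// gt_eqF.
apply: ler_sum => f _; rewrite !avgZ -mulrBr normrM.
rewrite -[leRHS]mul1r ler_pM//; last first.
  by apply: inv; exact: refl_isometry.
rewrite normr_prod; apply: prodr_ile1 => t _; by rewrite normr_ge0 l1.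
Qed.

Section Bernstein.
Context {R : realType}.
Implicit Types (F G : nat -> R) (x : R).

(** The Bernstein polynomial sum_i C(n,i) x^i (1-x)^(n-i) F(i), i.e. the mean of
F at a binomial variable, by conditioning on one of the n trials. *)
Fixpoint bernstein n F x : R :=
  if n is n'.+1 then
    x * bernstein n' (fun i => F i.+1) x + (1 - x) * bernstein n' F x
  else F 0.

Lemma bernstein_ext n F G x : F =1 G -> bernstein n F x = bernstein n G x.
Proof.
elim: n F G => [|n IH] F G FG /=; first exact: FG.
by congr (_ * _ + _ * _); apply: IH => // i; exact: FG.
Qed.

Lemma bernsteinD n F G x :
  bernstein n (fun i => F i + G i) x = bernstein n F x + bernstein n G x.
Proof. by elim: n F G => [//|n IH] F G /=; rewrite !IH; ring. Qed.

Lemma bernsteinZ n c F x :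
  bernstein n (fun i => c * F i) x = c * bernstein n F x.
Proof. by elim: n F => [//|n IH] F /=; rewrite !IH; ring. Qed.

Lemma bernstein_const n c x : bernstein n (fun=> c) x = c.
Proof. by elim: n => [//|n IH] /=; rewrite !IH; ring. Qed.

Lemma ler_bernstein n F G x : 0 <= x <= 1 ->
  (forall i, F i <= G i) -> bernstein n F x <= bernstein n G x.
Proof.
move=> /andP[x0 x1]; elim: n F G => [|n IH] F G FG /=; first exact: FG.
by rewrite lerD// ler_wpM2l ?subr_ge0//; apply: IH.
Qed.

(** Second moment of a binomial variable about c; the free centre c lets the
induction shift it. *)
Lemma bernstein_sqr n c x :
  bernstein n (fun i => (i%:R - c) ^+ 2) x =
  n%:R * x * (1 - x) + (n%:R * x - c) ^+ 2.
Proof.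
elim: n c => [|n IH] c /=; first by ring.
under [X in x * X]bernstein_ext => i.
  rewrite -natr1 -addrA [1 - c]addrC -[- c + 1]opprK opprD opprK.
  over.
by rewrite !IH -natr1; ring.
Qed.

(** With n = m^2 trials the frequency i/n has variance at most 1/(4 m^2) about
x, and h is compared with its mean through the Lipschitz bound. *)
Lemma bernstein_approx (m : nat) (h : R -> R) (t : R) :
  (0 < m)%N -> -1 <= t <= 1 -> (forall c c', `|h c - h c'| <= `|c - c'|) ->
  `|bernstein (m ^ 2) (fun i => h (2 * i%:R / (m ^ 2)%:R - 1)) ((1 + t) / 2) - h t|
    <= 2 / m%:R.
Proof.
move=> m0 /andP[t0 t1] lip; set n := (m ^ 2)%N; set x := (1 + t) / 2.
have x01 : 0 <= x <= 1 by rewrite /x; apply/andP; split; lra.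
have mp : 0 < m%:R :> R by rewrite ltr0n.
have nE : n%:R = m%:R ^+ 2 :> R by rewrite natrX.
have np : 0 < n%:R :> R by rewrite nE exprn_gt0.
(* From 2|y| <= y^2/m + m, which trades the first moment for the second. *)
have point i : `|h (2 * i%:R / n%:R - 1) - h t| <=
    n%:R^-1 * (m%:R^-1 * (i%:R - n%:R * x) ^+ 2 + m%:R).
  apply: (le_trans (lip _ _)).
  have -> : 2 * i%:R / n%:R - 1 - t = n%:R^-1 * (2 * (i%:R - n%:R * x)).
    by rewrite /x; field; rewrite gt_eqF.
  rewrite normrM ger0_norm ?invr_ge0 ?(ltW np)// ler_wpM2l ?invr_ge0 ?(ltW np)//.
  set y := _ - _.
  have : 0 <= m%:R^-1 * (`|y| - m%:R) ^+ 2.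
    by rewrite mulr_ge0 ?sqr_ge0// invr_ge0 ltW.
  rewrite normrM ger0_norm// sqrrB real_normK ?num_real// !mulrDr mulrN.
  have -> : m%:R^-1 * m%:R ^+ 2 = m%:R :> R by rewrite expr2 mulKf// gt_eqF.
  have -> : m%:R^-1 * (`|y| * m%:R *+ 2) = 2 * `|y| by field; rewrite gt_eqF.
  by lra.
pose F i := h (2 * i%:R / n%:R - 1).
pose Q i := n%:R^-1 * (m%:R^-1 * (i%:R - n%:R * x) ^+ 2 + m%:R).
have QE : bernstein n Q x <= 2 / m%:R.
  rewrite /Q bernsteinZ bernsteinD bernsteinZ bernstein_const bernstein_sqr.
  rewrite subrr expr0n addr0 nE.
  have -> : (m%:R ^+ 2)^-1 * (m%:R^-1 * (m%:R ^+ 2 * x * (1 - x)) + m%:R) =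
      (x * (1 - x) + 1) / m%:R by field; rewrite gt_eqF.
  rewrite ler_pM2r ?invr_gt0//.
  by move: x01 => /andP[? ?]; nra.
have hi : bernstein n F x <= h t + bernstein n Q x.
  rewrite -{1}(bernstein_const n (h t) x) -bernsteinD; apply: ler_bernstein => // i.
  have := point i; rewrite ler_norml => /andP[_]; rewrite /F /Q; lra.
have lo : h t <= bernstein n F x + bernstein n Q x.
  rewrite -{1}(bernstein_const n (h t) x) -bernsteinD; apply: ler_bernstein => // i.
  have := point i; rewrite ler_norml => /andP[]; rewrite /F /Q; lra.
by rewrite ler_norml -/F; apply/andP; split; lra.
Qed.

(** Each step of the recursion rewrites the polynomial as three polynomials of
lower index, times a power of x; the index [j] records that power. *)
Lemma bernstein_moments (T : Type) (s : seq T) (x y : T -> R) (N : nat) (e : R) :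
  (forall r, (r <= N)%N ->
    `|avg s (fun u => x u ^+ r) - avg s (fun u => y u ^+ r)| <= e) ->
  forall n j F, (j + n <= N)%N -> (forall i, (i <= n)%N -> `|F i| <= 1) ->
  `|avg s (fun u => x u ^+ j * bernstein n F (x u)) -
    avg s (fun u => y u ^+ j * bernstein n F (y u))| <= 3 ^+ n * e.
Proof.
move=> mom; elim=> [|n IH] j F jn F1 /=.
  under avg_ext do rewrite mulrC.
  under [X in _ - X]avg_ext do rewrite mulrC.
  rewrite !avgZ -mulrBr normrM expr0 mul1r.
  rewrite addn0 in jn; have := mom j jn; have := F1 0%N isT.
  move=> f1 m1; rewrite -[leRHS]mul1r ler_pM//.
have E (z : T -> R) :
    avg s (fun u => z u ^+ j * (z u * bernstein n (fun i => F i.+1) (z u) +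
                       (1 - z u) * bernstein n F (z u))) =
    avg s (fun u => z u ^+ j.+1 * bernstein n (fun i => F i.+1) (z u)) +
    avg s (fun u => z u ^+ j * bernstein n F (z u)) -
    avg s (fun u => z u ^+ j.+1 * bernstein n F (z u)).
  rewrite -avgD -avgB; apply: avg_ext => u; rewrite exprS; ring.
rewrite !E.
have jn' : (j.+1 + n <= N)%N by rewrite addSnnS.
have jn'' : (j + n <= N)%N by apply: leq_trans jn'; rewrite leq_add2r.
have Fn i : (i <= n)%N -> `|F i| <= 1 by move=> i_n; apply: F1; exact: leqW.
have i1 := IH j.+1 (fun i => F i.+1) jn' (fun i i_n => F1 i.+1 i_n).
have i2 := IH j F jn'' Fn.
have i3 := IH j.+1 F jn' Fn.
move: i1 i2 i3; rewrite exprS !ler_norml => /andP[? ?] /andP[? ?] /andP[? ?].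
by apply/andP; split; lra.
Qed.

End Bernstein.

(** The law of <a,u>, for u uniform on [s], is nearly the same for all unit
vectors a in the Wasserstein sense. Lipschitz functions are approximated by
Bernstein polynomials in (1 + <a,u>)/2, whose means are nearly invariant.
Symmetry is obtained by adjoining the opposite vectors. *)
Lemma sphere_design {R : realType} (k : nat) (e : R) : 0 < e ->
  exists s : seq 'rV[R]_k.+1,
    [/\ (0 < size s)%N, forall u, u \in s -> dot u u = 1,
        forall f : 'rV[R]_k.+1 -> R, avg s (fun u => f (- u)) = avg s f &
    forall a b, dot a a = 1 -> dot b b = 1 ->
    forall h : R -> R, (forall c c', `|h c - h c'| <= `|c - c'|) ->
      `|avg s (fun u => h (dot a u)) - avg s (fun u => h (dot b u))| <= e].
Proof.
move=> e0.
have [m m0 mE] : exists2 m, (0 < m)%N & 8 / m%:R <= e.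
  exists (Num.truncn (8 / e)).+1 => //.
  rewrite ler_pdivrMr ?ltr0n// mulrC -ler_pdivrMr//.
  by rewrite ltW// truncnS_gt.
set n := (m ^ 2)%N.
have e'0 : 0 < e / 2 / 3 ^+ n by rewrite !divr_gt0// exprn_gt0.
have [s [s0 s1 mom]] := near_invariant_moments k n e'0.
have close a b (h : R -> R) : dot a a = 1 -> dot b b = 1 ->
    (forall c c', `|h c - h c'| <= `|c - c'|) ->
    `|avg s (fun u => h (dot a u)) - avg s (fun u => h (dot b u))| <= e.
(* Normalised to vanish at 0, h is bounded by 1 on [-1, 1]. *)
  move=> a1 b1 lip; pose g c := h c - h 0.
  have glip c c' : `|g c - g c'| <= `|c - c'|.
    by rewrite /g opprB addrA subrK; exact: lip.
  have gE a' : avg s (fun u => h (dot a' u)) = avg s (fun u => g (dot a' u)) + h 0.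
    by rewrite /g avgB avg_const// subrK.
  rewrite !gE opprD addrACA subrr addr0.
  pose F i := g (2 * i%:R / n%:R - 1).
  have F1 i : (i <= n)%N -> `|F i| <= 1.
    move=> i_n; have := glip (2 * i%:R / n%:R - 1) 0.
    rewrite /g subrr !subr0 => /le_trans; apply.
    have np : 0 < n%:R :> R by rewrite ltr0n expn_gt0 m0.
    have : i%:R / n%:R <= 1 :> R by rewrite ler_pdivrMr// mul1r ler_nat.
    have : 0 <= i%:R / n%:R :> R by rewrite divr_ge0.
    by rewrite -mulrA ler_norml => ? ?; apply/andP; split; lra.
  have approx a' : dot a' a' = 1 -> `|avg s (fun u => g (dot a' u)) -
      avg s (fun u => bernstein n F ((1 + dot a' u) / 2))| <= 2 / m%:R.
    move=> a'1; rewrite -avgB (le_trans (ler_norm_avg _ _))//.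
    rewrite -[leRHS](avg_const _ s0); apply: ler_avg => u us.
    rewrite distrC; apply: bernstein_approx => //.
    by rewrite -ler_norml; apply: dot_unit_le1 => //; exact: s1.
  have := bernstein_moments (mom a b a1 b1) (n := n) (j := 0) (leqnn _) F1.
  under avg_ext do rewrite expr0 mul1r.
  under [X in _ - X]avg_ext do rewrite expr0 mul1r.
  have -> : 3 ^+ n * (e / 2 / 3 ^+ n) = e / 2.
    by rewrite mulrC divfK// expf_neq0// pnatr_eq0.
  have := approx a a1; have := approx b b1.
  rewrite !ler_norml => /andP[? ?] /andP[? ?] /andP[? ?].
  by apply/andP; split; lra.
exists (s ++ map (fun u => - u) s); split.
- by rewrite size_cat ltn_addr.
- move=> u; rewrite mem_cat => /orP[/s1//|/mapP[v vs ->]].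
  by rewrite dotNl dotNr opprK s1.
- move=> f; rewrite !avg_cat ?size_map// !avg_map /= addrC.
  by congr (_ * (_ + _)); apply: avg_ext => u /=; rewrite ?opprK.
- move=> a b a1 b1 h lip; rewrite !avg_cat ?size_map// !avg_map /=.
  have := close a b h a1 b1 lip.
  have := close a b (fun c => h (- c)) a1 b1.
  under avg_ext do rewrite -dotNr.
  under [X in _ - X]avg_ext do rewrite -dotNr.
  have lipN c c' : `|h (- c) - h (- c')| <= `|c - c'|.
    by apply: le_trans (lip _ _) _; rewrite -opprD normrN.
  move=> /(_ lipN).
  rewrite !ler_norml => /andP[? ?] /andP[? ?].
  by apply/andP; split; rewrite /comp /=; lra.
Qed.

(** The l_1 norm of a unit vector u is at least 1, so the means of |<e_i,u>| over
the k+1 coordinate vectors e_i add up to at least 1; all are nearly equal to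
the mean of |<a,u>|. *)
Lemma design_abs_ge {R : realType} (k : nat) (s : seq 'rV[R]_k.+1) (e : R) :
  (0 < size s)%N -> (forall u, u \in s -> dot u u = 1) ->
  (forall a b, dot a a = 1 -> dot b b = 1 ->
    `|avg s (fun u => `|dot a u|) - avg s (fun u => `|dot b u|)| <= e) ->
  forall a, dot a a = 1 -> k.+1%:R^-1 - e <= avg s (fun u => `|dot a u|).
Proof.
move=> s0 s1 inv a a1.
have : \sum_(i < k.+1) avg s (fun u => `|u 0 i|) <=
       \sum_(i < k.+1) (avg s (fun u => `|dot a u|) + e).
  apply: ler_sum => i _.
  have := inv a (delta_mx 0 i) a1; rewrite dot_delta mxE !eqxx => /(_ erefl).
  under [X in _ - X]avg_ext do rewrite dot_delta.
  by rewrite ler_norml => /andP[]; lra.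
have : 1 <= \sum_(i < k.+1) avg s (fun u => `|u 0 i|).
  rewrite -avg_sum -[leLHS](avg_const _ s0); apply: ler_avg => u us.
  rewrite -(s1 u us); apply: ler_sum => i _.
  rewrite -expr2 -real_normK ?num_real// expr2 ler_piMr//.
  exact/unit_coord_le1/s1.
move=> /le_trans h /h.
rewrite sumr_const card_ord -[_ *+ _]mulr_natl -ler_pdivrMl ?ltr0n// mulr1.
by rewrite lerBlDr.
Qed.

(** * The Dvoretzky--Rogers lemma *)

Section LinComb.
Context {R : realType} {Y : normedModType R} {N : nat}.
Implicit Types (y : 'I_N -> Y) (b c : 'rV[R]_N).

Definition lincomb y b : Y := \sum_i b 0 i *: y i.

Lemma lincombD y b c : lincomb y (b + c) = lincomb y b + lincomb y c.
Proof.
by rewrite /lincomb -big_split; apply: eq_bigr => i _; rewrite mxE scalerDl.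
Qed.

Lemma lincombZ y (a : R) b : lincomb y (a *: b) = a *: lincomb y b.
Proof.
by rewrite /lincomb scaler_sumr; apply: eq_bigr => i _; rewrite mxE scalerA.
Qed.

Lemma lincomb0 y : lincomb y 0 = 0.
Proof. by rewrite -(scale0r 0) lincombZ scale0r. Qed.

Lemma lincomb_sum (I : Type) (r : seq I) y (f : I -> 'rV[R]_N) :
  lincomb y (\sum_(i <- r) f i) = \sum_(i <- r) lincomb y (f i).
Proof.
elim: r => [|i r IH]; first by rewrite !big_nil lincomb0.
by rewrite !big_cons lincombD IH.
Qed.

Definition free_family y := forall b, lincomb y b = 0 -> b = 0.

Lemma lincomb_continuous y : continuous (lincomb y).
Proof.
apply: continuous_big => [|i _]; first exact: add_continuous.
by move=> c; apply: continuousZr_tmp; exact: coord_continuous.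
Qed.

(** On the compact unit sphere of the coefficients the norm of the combination
attains a minimum, positive by freeness. *)
Lemma free_family_lower y : free_family y ->
  exists2 k : R, 0 < k & forall b i, k * `|b 0 i| <= `|lincomb y b|.
Proof.
move=> yfree; have [N0|Npos] := posnP N.
  by exists 1 => // b i; have := ltn_ord i; rewrite {2}N0.
pose S := [set b : 'rV[R]_N | `|b| = 1]%classic.
have S0 : (S !=set0)%classic.
  have d0 : `|const_mx 1 : 'rV[R]_N| != 0.
    rewrite normr_eq0; apply/eqP => /rowP/(_ (Ordinal Npos)).
    by rewrite !mxE => /eqP; rewrite oner_eq0.
  exists (`|const_mx 1 : 'rV[R]_N|^-1 *: const_mx 1).
  by rewrite /S /= normrZ ger0_norm ?invr_ge0// mulVf.
have Sc : compact S.
  apply: bounded_closed_compact.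
    exists 1; split; first exact: num_real.
    by move=> x x1 b /= ->; exact: ltW.
  rewrite (_ : S = (fun b : 'rV[R]_N => `|b|) @^-1` [set 1])%classic//.
  by apply: closed_comp => [b _|]; [exact: norm_continuous|exact: closed_eq].
have cont : {within S, continuous (fun b => `|lincomb y b|)}.
  apply: continuous_subspaceT => b.
  by apply: continuous_comp; [exact: lincomb_continuous|exact: norm_continuous].
have [c cS cmin] := compact_EVT_min S0 Sc cont.
have c1 : `|c| = 1 by move: cS; rewrite inE.
exists `|lincomb y c|.
  rewrite normr_gt0; apply/eqP => /yfree c0.
  by move: c1; rewrite c0 normr0 => /eqP; rewrite eq_sym oner_eq0.
move=> b i; have [->|b0] := eqVneq b 0.
  by rewrite mxE normr0 mulr0 normr_ge0.
have bp : 0 < `|b| by rewrite normr_gt0.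
have coord : `|b 0 i| <= `|b|.
  rewrite [leRHS]/Num.norm /= mx_normrE.
  exact: (le_bigmax _ (fun ij : 'I_1 * 'I_N => `|b ij.1 ij.2|) (0, i)).
apply: (@le_trans _ _ (`|lincomb y c| * `|b|)); first by rewrite ler_wpM2l.
rewrite -ler_pdivlMr//.
have := cmin (`|b|^-1 *: b); rewrite inE /S /= normrZ ger0_norm ?invr_ge0//.
rewrite mulVf ?gt_eqF// => /(_ erefl).
by rewrite lincombZ normrZ ger0_norm ?invr_ge0// mulrC.
Qed.

End LinComb.

(** A free family cannot span, so some vector outside its span extends it. *)
Lemma exists_free_family {R : realType} {Y : normedModType R} (N : nat) :
  ~ finite_dimensional Y -> exists y : 'I_N -> Y, free_family y.
Proof.
move=> infY; elim: N => [|N [y yfree]].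
  by exists (fun=> 0) => b _; apply/rowP => -[].
have [x xy] : exists x, forall c : 'I_N -> R, x <> \sum_(i < N) c i *: y i.
  apply: contrapT => /forallNP no; apply: infY; exists N, y => x.
  by have /existsNP[c /contrapT ->] := no x; exists c.
exists (fun i => oapp y x (unlift ord0 i)) => b.
rewrite /lincomb big_ord_recl unlift_none /=.
under eq_bigr do rewrite liftK /=.
move=> b0; have b00 : b 0 ord0 = 0.
  apply: contrapT => /eqP nz; apply: (xy (fun i => - (b 0 ord0)^-1 * b 0 (lift ord0 i))).
  under eq_bigr do rewrite -scalerA.
  rewrite -scaler_sumr; move/eqP: b0; rewrite addrC addr_eq0 => /eqP ->.
  by rewrite scalerN scaleNr opprK scalerA mulVf// scale1r.
move: b0; rewrite b00 scale0r add0r => b0.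
have /rowP t0 : \row_i b 0 (lift ord0 i) = 0.
  by apply: yfree; rewrite -[RHS]b0; apply: eq_bigr => i _; rewrite mxE.
apply/rowP => i; rewrite mxE; case: (unliftP ord0 i) => [j ->|->//].
by have := t0 j; rewrite !mxE.
Qed.

Section Contractions.
Context {R : realType} {Y : normedModType R} {N : nat} (y : 'I_N -> Y).
Context (yfree : free_family y).
Implicit Types (A : 'M[R]_N) (b : 'rV[R]_N).

(** Rows of [A] are vectors in the coordinates [y]; as a linear map from
Euclidean space to the span of [y], [A] has norm at most 1. *)
Definition contraction A := forall b, `|lincomb y (b *m A)| ^+ 2 <= dot b b.

(** The rows of a contraction have norm at most 1, which bounds their
coefficients because [y] is free. *)
Lemma contraction_det_bounded :
  exists B : R, forall A, contraction A -> (\det A) ^+ 2 <= B.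
Proof.
have [k k0 klow] := free_family_lower yfree.
exists ((\sum_(s : 'S_N) k^-1 ^+ N) ^+ 2) => A Acon.
have entry i j : `|A i j| <= k^-1.
  rewrite -[leRHS]mulr1 -ler_pdivrMl ?invr_gt0// invrK.
  apply: (@le_trans _ _ `|lincomb y (row i A)|).
    by have := klow (row i A) j; rewrite mxE.
  rewrite -(@ler_sqr _ _ 1) ?nnegrE// expr1n rowE.
  by apply: (le_trans (Acon _)); rewrite dot_delta mxE !eqxx.
rewrite -real_normK ?num_real// ler_sqr ?nnegrE//; last first.
  by apply: sumr_ge0 => s _; rewrite exprn_ge0// invr_ge0 ltW.
rewrite /determinant (le_trans (ler_norm_sum _ _ _))//; apply: ler_sum => s _.
rewrite normrM normrX normrN1 expr1n mul1r normr_prod.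
rewrite -[N in leRHS]card_ord -prodr_const; apply: ler_prod => i _.
by rewrite normr_ge0 entry.
Qed.

Lemma exists_contraction : exists2 A, contraction A & 0 < (\det A) ^+ 2.
Proof.
pose S := \sum_i `|y i|.
have S0 : 0 <= S by exact: sumr_ge0.
have a0 : 0 < (1 + S)^-1 by rewrite invr_gt0; lra.
exists ((1 + S)^-1%:M); last by rewrite det_scalar !exprn_gt0.
move=> b; rewrite mul_mx_scalar lincombZ normrZ exprMn.
have q0 := sqrtr_ge0 (dot b b).
have nle : `|lincomb y b| <= Num.sqrt (dot b b) * S.
  rewrite mulr_sumr (le_trans (ler_norm_sum _ _ _))//; apply: ler_sum => i _.
  rewrite normrZ ler_wpM2r// -sqrtr_sqr ler_wsqrtr//.
  exact: coord_sqr_le_dot.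
rewrite -[leRHS](sqr_sqrtr (dot_ge0 b)) -exprMn ler_sqr ?nnegrE ?mulr_ge0//.
rewrite ger0_norm ?(ltW a0)// ler_pdivrMl; last by lra.
by apply: (le_trans nle); rewrite mulrDl mul1r mulrC lerDr.
Qed.

Definition refl_mx (n : 'rV[R]_N) : 'M[R]_N :=
  1%:M - (2 / dot n n) *: (n^T *m n).

Lemma mul_refl_mx n b : b *m refl_mx n = refl n b.
Proof.
rewrite /refl_mx mulmxBr mulmx1 -scalemxAr mulmxA /refl.
have -> : b *m n^T = (dot n b)%:M.
  apply/matrixP => i j; rewrite !ord1 !mxE eqxx mulr1n.
  by apply: eq_bigr => l _; rewrite mxE mulrC.
by rewrite mul_scalar_mx scalerA mulrAC.
Qed.

Lemma det_refl_mx n : (\det (refl_mx n)) ^+ 2 = 1.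
Proof.
rewrite expr2 -det_mulmx; have -> : refl_mx n *m refl_mx n = 1%:M.
  apply/row_matrixP => i; rewrite row_mul rowE -mulmxA !mulmxA !mul_refl_mx reflK.
  by rewrite row1.
by rewrite det1.
Qed.

Lemma contraction_refl n A : contraction A -> contraction (refl_mx n *m A).
Proof.
move=> Acon b; rewrite mulmxA (le_trans (Acon _))// mul_refl_mx.
by rewrite refl_isometry.
Qed.

(** If [A], whose squared determinant is more than half the supremum [S], mapped
every unit vector supported on the coordinates from j on to a vector shorter
than 1/4, those coordinates could be stretched by 4 at the cost of shrinking
all of them by sqrt(1/2). The result is still a contraction, but the squared
determinant at least doubles when at least half of the coordinates are
stretched. *)
Lemma long_direction (S : R) A (j : nat) : (0 < N)%N -> (j.*2 <= N)%N ->
  (forall B, contraction B -> (\det B) ^+ 2 <= S) ->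
  contraction A -> S / 2 < (\det A) ^+ 2 ->
  exists b, [/\ dot b b = 1, forall i : 'I_N, (i < j)%N -> b 0 i = 0 &
    4^-1 <= `|lincomb y (b *m A)|].
Proof.
move=> N0 jN Smax Acon Abig; apply: contrapT => noB.
have short b : (forall i : 'I_N, (i < j)%N -> b 0 i = 0) ->
    `|lincomb y (b *m A)| <= 4^-1 * Num.sqrt (dot b b).
  move=> bj; have [b0|b0] := eqVneq (dot b b) 0.
    by rewrite (dot_eq0 b0) mul0mx lincomb0 normr0 mulr_ge0 ?sqrtr_ge0.
  have q0 : 0 < Num.sqrt (dot b b) by rewrite sqrtr_gt0 lt_neqAle eq_sym b0 dot_ge0.
  rewrite leNgt; apply/negP => long; apply: noB.
  exists ((Num.sqrt (dot b b))^-1 *: b); split.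
  - rewrite dotZl dotZr mulrA -[dot b b in X in _ * X]sqr_sqrtr ?dot_ge0//.
    by field; rewrite gt_eqF.
  - by move=> i ij; rewrite mxE bj// mulr0.
  - rewrite -scalemxAl lincombZ normrZ ger0_norm ?invr_ge0 ?(ltW q0)//.
    by rewrite mulrC ler_pdivlMr// ltW.
pose k : R := Num.sqrt 2^-1.
have k2 : k ^+ 2 = 2^-1 by rewrite sqr_sqrtr// invr_ge0.
have k0 : 0 <= k by exact: sqrtr_ge0.
pose g (i : nat) : R := if (i < j)%N then k else 4 * k.
pose D : 'M[R]_N := diag_mx (\row_i g i).
have DAcon : contraction (D *m A).
  move=> b; pose b1 : 'rV[R]_N := \row_i (if (i < j)%N then b 0 i else 0).
  pose b2 : 'rV[R]_N := \row_i (if (i < j)%N then 0 else b 0 i).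
  have -> : b *m (D *m A) = k *: (b1 *m A) + (4 * k) *: (b2 *m A).
    rewrite mulmxA !scalemxAl -mulmxDl; congr (_ *m _); apply/rowP => i.
    rewrite mul_mx_diag !mxE /g; case: ifP => _; ring.
  have bE : dot b b = dot b1 b1 + dot b2 b2.
    rewrite /dot -big_split; apply: eq_bigr => i _; rewrite /= !mxE.
    by case: ifP => _; ring.
  rewrite lincombD !lincombZ bE.
  have n1 : `|lincomb y (b1 *m A)| <= Num.sqrt (dot b1 b1).
    by rewrite -[leLHS]ger0_norm// -sqrtr_sqr ler_wsqrtr// Acon.
  have n2 : `|lincomb y (b2 *m A)| <= 4^-1 * Num.sqrt (dot b2 b2).
    by apply: short => i ij; rewrite mxE ij.
  set p := Num.sqrt (dot b1 b1) in n1; set q := Num.sqrt (dot b2 b2) in n2.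
  rewrite -[X in _ <= X + _](sqr_sqrtr (dot_ge0 b1)).
  rewrite -[X in _ <= _ + X](sqr_sqrtr (dot_ge0 b2)) -/p -/q.
  have p0 : 0 <= p by exact: sqrtr_ge0.
  have q0 : 0 <= q by exact: sqrtr_ge0.
  apply: (@le_trans _ _ ((k * (p + q)) ^+ 2)).
    rewrite ler_sqr ?nnegrE ?mulr_ge0 ?addr_ge0//.
    apply: (le_trans (ler_normD _ _)); rewrite !normrZ !ger0_norm ?mulr_ge0//.
    have : k * `|lincomb y (b1 *m A)| <= k * p by rewrite ler_wpM2l.
    have : k * `|lincomb y (b2 *m A)| <= k * (4^-1 * q) by rewrite ler_wpM2l.
    by lra.
  by rewrite exprMn k2; have := sqr_ge0 (p - q); nra.
have := Smax _ DAcon; rewrite det_mulmx exprMn.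
suff : 2 <= (\det D) ^+ 2.
  move=> D2; have : 2 * \det A ^+ 2 <= \det D ^+ 2 * \det A ^+ 2.
    by rewrite ler_wpM2r// sqr_ge0.
  by lra.
(* The squared diagonal entries are 1/2 (j times) and 8 (N - j >= j times), so
   their product is at least 4^j 8^(N - 2j). *)
rewrite det_diag -prodrXl.
under eq_bigr do rewrite mxE.
rewrite -(big_mkord xpredT (fun i => g i ^+ 2)) (@big_cat_nat _ _ _ j)//=; last first.
  by apply: leq_trans jN; rewrite -addnn leq_addr.
rewrite (eq_big_nat _ _ (F2 := fun=> 2^-1)); last first.
  by move=> i /andP[_ ij]; rewrite /g ij.
rewrite [X in _ * X](eq_big_nat _ _ (F2 := fun=> 8)); last first.
  move=> i /andP[ji _]; rewrite /g ltnNge ji /= exprMn k2; lra.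
rewrite !prodr_const_nat subn0.
have -> : (N - j = j + (N - j.*2))%N.
  rewrite -addnn subnDA addnC subnK// leq_subRL; first by rewrite addnn.
  by apply: leq_trans jN; rewrite -addnn leq_addr.
rewrite exprD mulrA -exprMn.
have -> : 2^-1 * 8 = 4 :> R by lra.
apply: (@le_trans _ _ (2 ^+ (j + (N - j.*2)))); last first.
  rewrite exprD ler_pM ?exprn_ge0//; apply: lerXn2r; rewrite ?nnegrE//; lra.
rewrite -[leLHS]expr1 ler_eXn2l; last lra.
by case: (j) jN => [|j' //]; rewrite double0 subn0 add0n.
Qed.

(** A contraction of nearly maximal determinant is rotated by one reflection
per row: the reflection fixes the rows already treated and turns the next one
into the long direction. *)
Lemma long_rows (M : nat) : (0 < N)%N -> (M.*2 <= N)%N ->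
  exists2 A, contraction A &
    forall i : 'I_N, (i < M)%N -> 4^-1 <= `|lincomb y (row i A)|.
Proof.
move=> N0 MN.
pose E : set R := [set (\det A) ^+ 2 | A in contraction]%classic.
have [B Bmax] := contraction_det_bounded.
have [A0 A0con A0pos] := exists_contraction.
have E_sup : has_sup E.
  split; first by exists (\det A0 ^+ 2); exists A0.
  by exists B => _ [A Acon <-]; exact: Bmax.
have Smax A : contraction A -> (\det A) ^+ 2 <= sup E.
  by move=> Acon; apply: ub_le_sup; [exact: E_sup.2|exists A].
have Spos : 0 < sup E by exact: lt_le_trans A0pos (Smax _ A0con).
have half0 : 0 < sup E / 2 by rewrite divr_gt0.
have [_ [A1 A1con <-] A1big] := sup_adherent half0 E_sup.
have {}A1big : sup E / 2 < (\det A1) ^+ 2 by move: A1big; lra.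
suff : exists A, [/\ contraction A, sup E / 2 < (\det A) ^+ 2 &
    forall i : 'I_N, (i < M)%N -> 4^-1 <= `|lincomb y (row i A)|].
  by case=> A [? _ ?]; exists A.
elim: M MN => [|j IH] jN; first by exists A1.
have jN' : (j.*2 <= N)%N.
  by apply: leq_trans jN; rewrite leq_double.
have [A [Acon Abig Along]] := IH jN'.
have [b [b1 bj blong]] := long_direction N0 jN' Smax Acon Abig.
have jltN : (j < N)%N by apply: leq_trans jN; rewrite -addnn leq_addr.
pose i0 := Ordinal jltN; pose n : 'rV[R]_N := delta_mx 0 i0 - b.
exists (refl_mx n *m A); split; first exact: contraction_refl.
  by rewrite det_mulmx exprMn det_refl_mx mul1r.
move=> i; rewrite ltnS leq_eqVlt row_mul rowE mul_refl_mx.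
have d1 (l : 'I_N) : dot (delta_mx 0 l : 'rV[R]_N) (delta_mx 0 l) = 1.
  by rewrite dot_delta mxE !eqxx.
move=> /orP[/eqP ij|ij].
  have -> : i = i0 by exact: val_inj.
  by rewrite refl_swap// d1 b1.
suff -> : refl n (delta_mx 0 i) = delta_mx 0 i by rewrite -rowE Along.
rewrite /refl dotC dot_delta /n !mxE bj// eqxx /=.
have -> : (i == i0) = false by apply/eqP => ii; rewrite ii ltnn in ij.
by rewrite subrr mulr0 mul0r scale0r subr0.
Qed.

End Contractions.

(** The first half of the rows of a matrix as in [long_rows]. *)
Lemma dvoretzky_rogers {R : realType} {Y : normedModType R} (M : nat) :
  ~ finite_dimensional Y ->
  exists e : nat -> Y, (forall j, (j < M)%N -> 4^-1 <= `|e j|) /\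
    forall b : nat -> R,
      `|\sum_(j < M) b j *: e j| ^+ 2 <= \sum_(j < M) b j ^+ 2.
Proof.
case: M => [|M] infY.
  by exists (fun=> 0); split=> // b; rewrite !big_ord0 normr0 expr0n.
have [y yfree] := exists_free_family (M.+1).*2 infY.
have [A Acon Along] := long_rows yfree (isT : (0 < (M.+1).*2)%N) (leqnn _).
have MN : (M.+1 <= (M.+1).*2)%N by rewrite -addnn leq_addr.
exists (fun j => lincomb y (row (inord j) A)); split.
  move=> j jM; apply: Along; rewrite inordK//; exact: leq_trans MN.
move=> b.
pose b' : 'rV[R]_(M.+1).*2 := \row_i (if (i < M.+1)%N then b i else 0).
have := Acon b'.
have -> : lincomb y (b' *m A) =
    \sum_(j < M.+1) b j *: lincomb y (row (inord j) A).
  rewrite mulmx_sum_row lincomb_sum.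
  rewrite (big_ord_widen _ (fun j => b j *: lincomb y (row (inord j) A)) MN).
  rewrite big_mkcond [RHS]big_mkcond; apply: eq_bigr => i _ /=.
  rewrite lincombZ mxE inord_val; case: ifP => // _; exact: scale0r.
have -> // : dot b' b' = \sum_(j < M.+1) b j ^+ 2.
rewrite (big_ord_widen _ (fun j => b j ^+ 2) MN) big_mkcond.
by apply: eq_bigr => i _; rewrite mxE; case: ifP => _; rewrite ?mul0r.
Qed.

(** * Almost Euclidean sections *)

(** Repeating n+1 times each of 2^n Dvoretzky--Rogers vectors gives mean norm at
least (n+1)/8 and upper constant n+1; dividing the vectors by (n+1)/8 makes the
upper constant 64/(n+1). *)
Lemma flat_rademacher_family {R : realType} {Y : normedModType R} (eta : R) :
  ~ finite_dimensional Y -> 0 < eta ->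
  exists (m : nat) (w : nat -> Y),
    1 <= mean_norm [:: 1; -1] m w 0 /\
    forall b : nat -> R,
      `|\sum_(t < m) b t *: w t| ^+ 2 <= eta * \sum_(t < m) b t ^+ 2.
Proof.
move=> infY eta0; pose n := Num.truncn (64 / eta).
have nE : 64 / n.+1%:R <= eta.
  by rewrite ler_pdivrMr ?ltr0n// mulrC -ler_pdivrMr// ltW// truncnS_gt.
have [e [long e2]] := dvoretzky_rogers (2 ^ n) infY.
have np : 0 < n.+1%:R :> R by rewrite ltr0n.
pose a : R := 8 / n.+1%:R.
have a0 : 0 <= a by rewrite divr_ge0.
exists (2 ^ n * n.+1)%N, (fun t => a *: e (t %/ n.+1)%N); split.
  rewrite -[X in mean_norm _ _ _ X](scaler0 _ a) mean_norm_scale//.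
  have c0 : 0 <= 4^-1 :> R by rewrite invr_ge0.
  have := ler_wpM2l a0 (rad_repeat_ge c0 long); apply: le_trans.
  rewrite /a le_eqVlt; apply/orP; left; apply/eqP; field.
  by rewrite gt_eqF.
move=> b.
under eq_bigr do rewrite scalerA mulrC -scalerA.
rewrite -scaler_sumr normrZ exprMn real_normK ?num_real//.
apply: (le_trans (ler_wpM2l (sqr_ge0 a) (repeat_upper2 n e2 b))).
rewrite mulrA ler_wpM2r//; first by apply: sumr_ge0 => t _; exact: sqr_ge0.
suff -> : a ^+ 2 * n.+1%:R = 64 / n.+1%:R by [].
by rewrite /a; field; rewrite gt_eqF.
Qed.

(** The random map has, on each direction a, a norm concentrated around a mean
[psi a] that is at least 1/(2K) and nearly independent of a. Scaled by the
inverse of one such mean, it is nearly isometric on the given differences. The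
order of choices matters: first [eta] (variance), which fixes the vectors [w]
and their number [m], and only then the accuracy [e] of the design, which has
to beat [m]. *)
Lemma dvoretzky {R : realType} {Y : normedModType R} (k : nat) (V : finType)
    (p : V -> 'rV[R]_k.+1) (eps : R) :
  ~ finite_dimensional Y -> 0 < eps ->
  exists y : V -> Y, forall v v',
    `| `|y v - y v'| - Num.sqrt (dot (p v - p v') (p v - p v'))| <= eps.
Proof.
move=> infY eps0; pose K : R := k.+1%:R.
have K0 : 0 < K by rewrite ltr0n.
pose d (q : V * V) := p q.1 - p q.2.
pose L q := Num.sqrt (dot (d q) (d q)).
have L0 q : 0 <= L q by exact: sqrtr_ge0.
pose e1 : 'rV[R]_k.+1 := delta_mx 0 ord0.
have e1_unit : dot e1 e1 = 1 by rewrite dot_delta mxE !eqxx.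
(* Directions of the differences; [e1] stands in where a difference vanishes,
   so that all the [a q] are unit vectors. *)
pose a q := if L q == 0 then e1 else (L q)^-1 *: d q.
have dE q : d q = L q *: a q.
  rewrite /a; case: eqP => [Lq|/eqP Lq]; last by rewrite scalerA divff// scale1r.
  rewrite Lq scale0r; apply: dot_eq0.
  by rewrite -[LHS]sqr_sqrtr ?dot_ge0// -/(L q) Lq expr0n.
have a_unit q : dot (a q) (a q) = 1.
  rewrite /a; case: eqP => // /eqP Lq.
  rewrite dotZl dotZr -[dot _ _]sqr_sqrtr ?dot_ge0// -/(L q).
  by field.
pose delta : R := eps / (1 + \sum_q L q).
have den0 : 0 < 1 + \sum_q L q by have : 0 <= \sum_q L q by [exact: sumr_ge0]; lra.
have delta0 : 0 < delta by rewrite divr_gt0.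
have Ldelta q : L q * delta <= eps.
  rewrite /delta mulrA mulrAC ler_piMl ?(ltW eps0)// ler_pdivrMr// mul1r.
  rewrite (bigD1 q)//=; have : 0 <= \sum_(i | i != q) L i by exact: sumr_ge0.
  by lra.
pose r : R := delta / (4 * K).
have r0 : 0 < r by rewrite divr_gt0// mulr_gt0.
pose NS : R := #|{: V * V}|%:R + 1.
have NS0 : 0 < NS by rewrite /NS ltr_wpDl.
pose eta : R := Num.min 1 (r ^+ 2 / (4 * NS)).
have eta0 : 0 < eta by rewrite lt_min ltr01 divr_gt0// ?exprn_gt0// mulr_gt0.
have [m [w [radw w2]]] := flat_rademacher_family infY eta0.
have w1 t : (t < m)%N -> `|w t| <= 1.
  move=> tm; rewrite -(@ler_sqr _ _ 1) ?nnegrE// expr1n.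
  have := w2 (fun i => (i == t)%:R).
  rewrite (bigD1 (Ordinal tm))//= eqxx scale1r big1 ?addr0 => [|i it]; last first.
    by rewrite (_ : (i == t :> nat) = false) ?scale0r//; apply/negbTE.
  rewrite (bigD1 (Ordinal tm))//= eqxx expr1n big1 ?addr0 => [|i it]; last first.
    by rewrite (_ : (i == t :> nat) = false) ?expr0n//; apply/negbTE.
  by rewrite mulr1 => /le_trans; apply; rewrite ge_min lexx.
pose e := Num.min (2 * K)^-1 (r / m.+1%:R).
have e0 : 0 < e by rewrite lt_min invr_gt0 mulr_gt0//= divr_gt0.
have [s [s0 s1 sym inv]] := sphere_design k e0.
pose psi b := mean_norm (map (dot b) s) m w 0.
have size_map0 b : (0 < size (map (dot b) s))%N by rewrite size_map.
have psi_inv b b' : dot b b = 1 -> dot b' b' = 1 -> `|psi b - psi b'| <= r.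
  move=> b1 b'1; apply: (@le_trans _ _ (m%:R * e)).
    apply: mean_norm_compare => // h lip; rewrite !avg_map.
    exact: inv.
  have er : e <= r / m.+1%:R by rewrite ge_min lexx orbT.
  apply: (@le_trans _ _ (m.+1%:R * e)).
    by rewrite ler_wpM2r ?(ltW e0)// ler_nat.
  by rewrite mulrC -ler_pdivlMr.
have psi_low b : dot b b = 1 -> (2 * K)^-1 <= psi b.
  move=> b1; have lipn (c c' : R) : `| `|c| - `|c'| | <= `|c - c'| by exact: ler_dist_dist.
  have inv' b0 b' : dot b0 b0 = 1 -> dot b' b' = 1 ->
      `|avg s (fun u => `|dot b0 u|) - avg s (fun u => `|dot b' u|)| <= e.
    by move=> b01 b'1; apply: (inv b0 b' b01 b'1 Num.norm).
  have := design_abs_ge s0 s1 inv' b1; rewrite -/K.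
  have eK : e <= (2 * K)^-1 by rewrite ge_min lexx.
  have KK : K^-1 = (2 * K)^-1 + (2 * K)^-1 by field; rewrite gt_eqF.
  have -> : avg s (fun u => `|dot b u|) = avg (map (dot b) s) Num.norm by rewrite avg_map.
  set c := avg _ _ => clow.
  have c0 : (2 * K)^-1 <= c by apply: le_trans clow; rewrite KK lerBrDr lerD2l.
  apply: (le_trans c0).
  have c00 : 0 <= c by apply: le_trans c0; rewrite invr_ge0 mulr_ge0// ltW.
  have symb (f : R -> R) :
      avg (map (dot b) s) (fun c => f (- c)) = avg (map (dot b) s) f.
    rewrite !avg_map -[RHS]sym; apply: avg_ext => u /=.
    by rewrite dotNr.
  apply: le_trans (mean_norm_contraction m w 0 (size_map0 b) symb).
  rewrite -/c -[X in mean_norm _ _ _ X](scaler0 _ c) mean_norm_scale//.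
  by rewrite -[leLHS]mulr1 ler_wpM2l.
pose phi q us := `|0 + \sum_(t < m) dot (a q) (nth 0 us t) *: w t|.
have mean_phi q : iavg m s (phi q) = psi (a q) by exact: iavg_normE.
have var_phi q : iavg m s (fun us => (phi q us - psi (a q)) ^+ 2) <= 4 * eta.
  have -> : iavg m s (fun us => (phi q us - psi (a q)) ^+ 2) =
      iavg m s (fun us => phi q us ^+ 2) - iavg m s (phi q) ^+ 2.
    rewrite mean_phi; set c := psi _.
    transitivity (iavg m s (fun us => phi q us ^+ 2 + (c ^+ 2 - 2 * c * phi q us))).
      by apply: iavg_ext => us; ring.
    by rewrite iavgD iavgB iavg_const// iavgZ mean_phi -/c; ring.
  apply: variance_norm_le => //; last exact: ltW.
  move=> u v us vs.
  have := dot_unit_le1 (a_unit q) (s1 u us); have := dot_unit_le1 (a_unit q) (s1 v vs).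
  rewrite !ler_norml => /andP[? ?] /andP[? ?]; nra.
have [us [usm uss good]] := iavg_le_witness m
  (fun us => \sum_q (phi q us - psi (a q)) ^+ 2) s0.
have phi_close q : `|phi q us - psi (a q)| <= r.
  rewrite -(@ler_sqr _ _ r) ?nnegrE ?(ltW r0)// real_normK ?num_real//.
  apply: (@le_trans _ _ (\sum_q (phi q us - psi (a q)) ^+ 2)).
    rewrite (bigD1 q)//= lerDl; apply: sumr_ge0 => *; exact: sqr_ge0.
  apply: (le_trans good); rewrite iavg_sum//.
  apply: (@le_trans _ _ (\sum_(q : V * V) 4 * eta)); first exact: ler_sum.
  rewrite sumr_const -[_ *+ _]mulr_natl.
  apply: (@le_trans _ _ (NS * (4 * eta))).
    by rewrite ler_wpM2r ?mulr_ge0 ?(ltW eta0)// /NS lerDl.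
  have : eta <= r ^+ 2 / (4 * NS) by rewrite ge_min lexx orbT.
  by rewrite ler_pdivlMr ?mulr_gt0//; lra.
pose c := psi e1.
have clow : (2 * K)^-1 <= c by exact: psi_low.
have c0 : 0 < c by apply: lt_le_trans clow; rewrite invr_gt0 mulr_gt0.
have close q : `|phi q us - c| <= c * delta.
  apply: (@le_trans _ _ ((2 * K)^-1 * delta)); last by rewrite ler_wpM2r ?(ltW delta0).
  have -> : (2 * K)^-1 * delta = r + r by rewrite /r; field; rewrite gt_eqF.
  have -> : phi q us - c = (phi q us - psi (a q)) + (psi (a q) - c).
    by rewrite addrA subrK.
  by rewrite (le_trans (ler_normD _ _))// lerD// psi_inv.
exists (fun v => c^-1 *: \sum_(t < m) dot (p v) (nth 0 us t) *: w t) => v v'.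
pose q := (v, v').
have -> : `|c^-1 *: (\sum_(t < m) dot (p v) (nth 0 us t) *: w t) -
    c^-1 *: (\sum_(t < m) dot (p v') (nth 0 us t) *: w t)| = L q * (c^-1 * phi q us).
  have -> : phi q us = `|\sum_(t < m) dot (a q) (nth 0 us t) *: w t|.
    by rewrite /phi add0r.
  rewrite -scalerBr normrZ ger0_norm ?invr_ge0 ?(ltW c0)// mulrCA; congr (_ * _).
  rewrite -[L q in RHS]ger0_norm// -normrZ; congr `|_|.
  rewrite scaler_sumr -sumrB; apply: eq_bigr => t _.
  by rewrite scalerA -dotZl -dE -scalerBl /d dotDl dotNl.
rewrite -/(d q) -/(L q).
have -> : L q * (c^-1 * phi q us) - L q = L q * (c^-1 * (phi q us - c)).
  by field; rewrite gt_eqF.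
rewrite normrM ger0_norm//; apply: le_trans (Ldelta q).
rewrite ler_wpM2l// normrM ger0_norm ?invr_ge0 ?(ltW c0)//.
by rewrite ler_pdivrMl// close.
Qed.

(** * Flattenability *)

(** A spanning family of least size is free: a nontrivial relation would allow
one of its vectors to be dropped. *)
Lemma finite_dimensional_basis {R : realType} {X : normedModType R} :
  finite_dimensional X ->
  exists (n : nat) (b : 'I_n -> X),
    free_family b /\ forall x, exists c, x = lincomb b c.
Proof.
move=> [n0 [b0 span0]].
pose P n := `[< exists b : 'I_n -> X, forall x, exists c, x = lincomb b c >].
have exP : exists n, P n.
  exists n0; apply/asboolP; exists b0 => x; have [c ->] := span0 x.
  by exists (\row_i c i); apply: eq_bigr => i _; rewrite mxE.
case: (ex_minnP exP) => n /asboolP[b span] min.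
exists n, b; split=> // c c0; apply: contrapT => cN0.
have [i ci] : exists i, c 0 i != 0.
  apply: contrapT => /forallNP ci; apply: cN0; apply/rowP => i; rewrite mxE.
  by apply/eqP/negPn/negP; exact: ci.
case: n b span min c c0 {cN0} i ci => [|n] b span min c c0 i ci; first by case: i ci.
suff /min : P n by rewrite ltnn.
apply/asboolP; exists (fun j => b (lift i j)) => x.
have [l ->] := span x.
exists (\row_j (l 0 (lift i j) - l 0 i / c 0 i * c 0 (lift i j))).
have dec (l' : 'rV[R]_n.+1) : lincomb b l' =
    l' 0 i *: b i + \sum_j l' 0 (lift i j) *: b (lift i j).
  by rewrite /lincomb (bigD1_ord i).
transitivity (lincomb b l - (l 0 i / c 0 i) *: lincomb b c).
  by rewrite c0 scaler0 subr0.
rewrite !dec scalerDr opprD addrACA scalerA divfK// subrr add0r.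
rewrite scaler_sumr -sumrB; apply: eq_bigr => j _.
by rewrite mxE scalerBl scalerA.
Qed.

Section Closed.
Context {R : realType} {X : normedModType R} {G : sgraph}.

Definition adj (u v : G) := [set u; v]%SET \in edge_set G.

Lemma adj_sym : symmetric adj.
Proof. by move=> u v; rewrite /adj finset.setUC. Qed.

Lemma measurement_adj (x : G -> X) u v (uv : adj u v) :
  `|x u - x v| = measurement x (exist _ [set u; v]%SET uv).
Proof. by rewrite (measurementE x (v := u) (w := v)). Qed.

Lemma adj_edge_ends (e : edge G) : adj (edge_ends e).1 (edge_ends e).2.
Proof.
have /eqP := xchooseP (edge_has_ends e).
by rewrite -/(edge_ends e) /adj => <-; exact: (valP e).
Qed.

(** Translating each connected component keeps all edge lengths and puts one
vertex of each component at the origin. Placements are controlled only through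
edges, so the components have to be translated separately. *)
Definition anchored (x : G -> X) (v : G) := x v - x (fingraph.root adj v).

Lemma measurement_anchored (x : G -> X) : measurement (anchored x) = measurement x.
Proof.
apply/ffunP => e; rewrite !ffunE /anchored.
have /connect1/(fingraph.rootP (sym_connect_sym adj_sym)) -> := adj_edge_ends e.
by rewrite opprB addrA subrK.
Qed.

(** A vertex is joined to the root of its component by a path without repeated
vertices. *)
Lemma anchored_le (x : G -> X) (D : R) v :
  (forall e, measurement x e <= D) -> 0 <= D -> `|anchored x v| <= #|G|%:R * D.
Proof.
move=> xD D0; rewrite /anchored; have := connect_root adj v.
case/connectP => p0 /shortenP[p vp up _] ->.
apply: (@le_trans _ _ ((size p)%:R * D)); last first.
  rewrite ler_wpM2r// ler_nat; apply: leq_trans (max_card (mem (v :: p))).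
  by rewrite (card_uniqP up).
elim: p {up} v vp => [|u p IH] v /=; first by rewrite subrr normr0 mul0r.
move=> /andP[vu up]; rewrite -(subrK (x u) (x v)) -addrA.
rewrite (le_trans (ler_normD _ _))// -nat1r mulrDl mul1r lerD//.
  by rewrite measurement_adj.
exact: IH.
Qed.

(** Anchored placements with edge lengths close to [d] have bounded coordinates
in a basis of [X]; the total error in the edge lengths attains its minimum on
the corresponding compact box, and that minimum is 0. *)
Lemma realization_of_approx (d : {ffun edge G -> R}) :
  finite_dimensional X ->
  (forall eps : R, 0 < eps ->
    exists x : G -> X, forall e, `|measurement x e - d e| <= eps) ->
  exists x : G -> X, measurement x = d.
Proof.
move=> /finite_dimensional_basis[n [b [bfree span]]] approx.
have [k k0 klow] := free_family_lower bfree.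
pose D : R := 1 + \sum_e `|d e|.
have D0 : 0 <= D by rewrite addr_ge0// sumr_ge0.
pose B := k^-1 * (#|G|%:R * D).
have B0 : 0 <= B by rewrite mulr_ge0 ?invr_ge0 ?(ltW k0)// mulr_ge0.
pose place (c : 'rV[R]_(#|G| * n)) (v : G) : X :=
  \sum_i c 0 (mxvec_index (enum_rank v) i) *: b i.
pose err c := \sum_e `|measurement (place c) e - d e|.
pose box := [set c : 'rV[R]_(#|G| * n) | forall i, `[- B, B]%classic (c ord0 i)].
have box0 : box !=set0.
  by exists 0 => i /=; rewrite mxE in_itv /= oppr_le0 B0.
have boxc : compact box.
  by apply: (@rV_compact _ _ (fun=> `[- B, B]%classic)) => _; exact: segment_compact.
have placec v : continuous (place ^~ v).
  apply: continuous_big => [|i _]; first exact: add_continuous.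
  by move=> c; apply: continuousZr_tmp; exact: coord_continuous.
have errc : {within box, continuous err}.
  apply: continuous_subspaceT.
  apply: continuous_big => [|e _]; first exact: add_continuous.
  set v := (edge_ends e).1; set w := (edge_ends e).2.
  have -> : (fun c => `|measurement (place c) e - d e|) =
      (fun c => `| `|place c v - place c w| - d e|).
    by apply/funext => c; rewrite ffunE.
  move=> c; apply: (@continuous_comp _ _ _
    (fun c => `|place c v - place c w| - d e) Num.norm); last exact: norm_continuous.
  apply: (@continuousB _ _ _ (fun c => `|place c v - place c w|) (fun=> d e));
    last exact: cst_continuous.
  apply: (@continuous_comp _ _ _ (fun c => place c v - place c w) Num.norm);
    last exact: norm_continuous.
  by apply: (@continuousB _ _ _ (place ^~ v) (place ^~ w)); exact: placec.
have [c cbox cmin] := compact_EVT_min box0 boxc errc.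
have small (eps : R) : 0 < eps -> err c <= eps.
  move=> eps0; pose eta := Num.min 1 (eps / (#|{: edge G}|%:R + 1)).
  have den0 : 0 < #|{: edge G}|%:R + 1 :> R by rewrite ltr_wpDl.
  have eta0 : 0 < eta by rewrite lt_min ltr01 divr_gt0.
  have [x xd] := approx eta eta0.
  have xD e : measurement x e <= D.
    have := xd e; have := ler_norm (d e).
    rewrite ler_norml => dle /andP[_ le].
    have eta1 : eta <= 1 by rewrite ge_min lexx.
    rewrite /D (bigD1 e)//=; have : 0 <= \sum_(i | i != e) `|d i| by exact: sumr_ge0.
    by lra.
  have [f fE] : exists f : G -> 'rV[R]_n, forall v, anchored x v = lincomb b (f v).
    by have [f] := choice (fun v => span (anchored x v)); exists f.
  pose c' : 'rV[R]_(#|G| * n) :=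
    mxvec (\matrix_(l < #|G|, i < n) f (enum_val l) 0 i).
  have place' v : place c' v = anchored x v.
    rewrite fE /place; apply: eq_bigr => i _.
    by rewrite /c' mxvecE mxE enum_rankK.
  have c'box : c' \in box.
    rewrite inE => j; case/mxvec_indexP: j => l i.
    rewrite /= /c' mxvecE mxE in_itv /= -ler_norml.
    rewrite ler_pdivlMl//; apply: (le_trans (klow _ _)).
    by rewrite -fE; exact: anchored_le.
  apply: (le_trans (cmin _ c'box)); rewrite /err.
  have -> : place c' = anchored x by apply/funext => v; exact: place'.
  rewrite measurement_anchored.
  apply: (@le_trans _ _ (\sum_(e : edge G) eta)); first exact: ler_sum.
  rewrite sumr_const -[_ *+ _]mulr_natl.
  have : eta <= eps / (#|{: edge G}|%:R + 1) by rewrite ge_min lexx orbT.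
  by rewrite ler_pdivlMr//; lra.
have err0 : err c = 0.
  apply/eqP; rewrite eq_le sumr_ge0// andbT; apply/ler_addgt0Pr => eps eps0.
  by rewrite add0r small.
exists (place c); apply/ffunP => e; apply/eqP; rewrite -subr_eq0 -normr_eq0.
have := psumr_eq0P (fun e _ => normr_ge0 (measurement (place c) e - d e)) err0.
by move=> ->.
Qed.

End Closed.

Section Sequences.
Context {R : realType}.

Lemma bounded_in_ell_infty (x : nat -> R) (B : R) :
  (forall k, `|x k| <= B) -> x \in ell_pred +oo%E.
Proof.
move=> xB; apply/asboolP; apply: (@le_lt_trans _ _ B%:E); last exact: ltry.
by apply: ge_ereal_sup => _ [k _ <-]; rewrite lee_fin.
Qed.

(** The point v is sent to the function u |-> |y v - y u|: by the triangle
inequality two such functions are within |y v - y w| of each other, and at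
u = w they differ by exactly that much. *)
Lemma frechet_embedding (V : finType) (Y : normedModType R) (y : V -> Y) :
  exists x : V -> ell_infty R, forall v w, `|x v - x w| = `|y v - y w|.
Proof.
(* The vertices are enumerated by natural numbers, and the sequences are
   extended by 0. *)
pose a v k := oapp (fun u => `|y v - y u|) 0 (nth None (map some (enum V)) k).
have aB v k : `|a v k| <= \sum_u `|y v - y u|.
  rewrite /a; case: (nth _ _ _) => [u|] /=; last by rewrite normr0 sumr_ge0.
  by rewrite normr_id (bigD1 u)//= lerDl sumr_ge0.
pose x v : ell_infty R := Ell (leey 1%E) (bounded_in_ell_infty (aB v)).
exists x => v w; apply: EFin_inj; rewrite ell_normrE /=.
apply/eqP; rewrite eq_le; apply/andP; split.
  apply: ge_ereal_sup => _ [k _ <-]; rewrite lee_fin.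
  rewrite -[X in `|X|]/(a v k - a w k) /a.
  case: (nth _ _ _) => [u|] /=; last by rewrite subrr normr0.
  by apply: (le_trans (ler_dist_dist _ _)); rewrite opprB addrA subrK.
apply: ereal_sup_ubound; exists (index w (enum V)) => //.
rewrite -[X in `|X|%:E]/(a v _ - a w _) /a.
have iw : (index w (enum V) < size (enum V))%N by rewrite index_mem mem_enum.
by rewrite (nth_map w)// nth_index ?mem_enum//= subrr normr0 subr0 normr_id.
Qed.

Lemma ell_two_truncation (x : ell_two R) (eps : R) : 0 < eps ->
  exists K0 : nat, forall K, (K0 <= K)%N ->
    `| `|x| - Num.sqrt (\sum_(i < K) x i ^+ 2)| <= eps.
Proof.
move=> eps0; pose u n : R := \sum_(0 <= i < n) x i ^+ 2.
have sqE i : `|x i| `^ 2 = x i ^+ 2.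
  by rewrite powR_mulrn// real_normK ?num_real.
have u0 n : 0 <= u n by apply: sumr_ge0 => i _; exact: sqr_ge0.
have nE := ell_normrE x; rewrite /= in nE.
set S := (\sum_(k <oo) _)%E in nE.
have S0 : (0 <= S)%E by apply: nneseries_ge0 => i _ _; rewrite lee_fin powR_ge0.
have uS : (u n)%:E @[n --> \oo] --> S.
  have := @is_cvg_nneseries R (fun k => (`|x k| `^ 2)%:E) xpredT 0
    (fun n _ _ => powR_ge0 _ _).
  rewrite /S; apply: cvg_trans; apply: near_eq_cvg; near=> n.
  by rewrite sumEFin; congr EFin; apply: eq_bigr => i _; rewrite sqE.
have Sfin : S \is a fin_num.
  rewrite ge0_fin_numE// ltey; apply/eqP => Soo.
  by move: nE; rewrite Soo poweRyr// invr_eq0 pnatr_eq0.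
have nS : `|x| = Num.sqrt (fine S).
  apply: EFin_inj; rewrite nE -{1}(fineK Sfin) poweR_EFin.
  by rewrite -powR12_sqrt// fine_ge0.
have cvgu : u n @[n --> \oo] --> fine S.
  by move: uS; rewrite -(fineK Sfin) => /fine_cvg.
have : Num.sqrt (u n) @[n --> \oo] --> `|x|.
  by rewrite nS; exact: (cvg_comp _ _ cvgu (@sqrt_continuous R _)).
move=> /cvgrPdist_le/(_ _ eps0)[K0 _ near]; exists K0 => K KK0.
by have := near K KK0; rewrite /u /= big_mkord.
Unshelve. all: by end_near. Qed.

End Sequences.

Theorem theorem5p1 (R : realType) (X Y : normedModType R)
    (hX : nontrivial X) (hY : nontrivial Y) (G : sgraph) :
  (flattenable X (ell_infty R) G -> flattenable X Y G) /\
  (finite_dimensional X -> ~ finite_dimensional Y ->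
   flattenable X Y G -> flattenable X (ell_two R) G).
Proof.
split=> [flat _ [y _ <-]|finX infY flat _ [z _ <-]].
  have [x xy] := frechet_embedding y.
  have -> : measurement y = measurement x.
    by apply/ffunP => e; rewrite !ffunE xy.
  by apply: flat; exists x.
suff [x <-] : exists x : G -> X, measurement x = measurement z by exists x.
apply: realization_of_approx => // eps eps0.
have eps2 : 0 < eps / 2 by rewrite divr_gt0.
have [K0 trunc] : exists K0 : G * G -> nat, forall q K, (K0 q <= K)%N ->
    `| `|z q.1 - z q.2| - Num.sqrt (\sum_(i < K) (z q.1 - z q.2) i ^+ 2)| <= eps / 2.
  by have [K0] := choice (fun q : G * G => ell_two_truncation (z q.1 - z q.2) eps2);
    exists K0.
pose K := \max_q K0 q.
pose p v : 'rV[R]_K.+1 := \row_i z v i.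
have [y yp] := dvoretzky p infY eps2.
have [x _ xy] : range (@measurement R G X) (measurement y).
  by apply: flat; exists y.
exists x => e; rewrite xy !ffunE; set v := _.1; set w := _.2.
have := yp v w; have := trunc (v, w) K.+1 (leqW (leq_bigmax (v, w))).
have -> : \sum_(i < K.+1) (z v - z w) i ^+ 2 = dot (p v - p w) (p v - p w).
  by apply: eq_bigr => i _; rewrite !mxE -expr2.
rewrite /= !ler_norml => /andP[? ?] /andP[? ?].
by apply/andP; split; lra.
Qed.
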